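(* Let $H$ be a compact group and let $\iota_i:H\to G_i$, $i\in I$, be a family (of arbitrary size) of embeddings of compact groups such that each image $\iota_i(H)$ is a normal subgroup of $G_i$. Then the family $(\iota_i)_{i\in I}$ is algebraically sound if and only if it is coherently embeddable in the category of compact groups.
   Context: Compact groups are compact Hausdorff topological groups; the category of compact groups has continuous homomorphisms as morphisms. An embedding is an injective continuous homomorphism. For a family of embeddings $\iota_i:H\to G_i$, $i\in I$, of compact groups, the multi-pushout is the colimit of the diagram formed by the $\iota_i$. Write $\coprod_{H,\mathrm{Gp}}G_i$ for the multi-pushout in the category of abstract groups (the free product of the $G_i$ amalgamated over $H$) and $\coprod_{H,\mathrm{CGp}}G_i$ for the multi-pushout in the category of compact groups. There is a canonical group homomorphism $\coprod_{H,\mathrm{Gp}}G_i\to\coprod_{H,\mathrm{CGp}}G_i$ induced by the structure maps $G_i\to\coprod_{H,\mathrm{CGp}}G_i$. The family $(\iota_i)$ is algebraically sound if this canonical homomorphism is injective. The family $(\iota_i)$ is coherently embeddable (in compact groups) if there are a compact group $G$ and embeddings of compact groups $j_i:G_i\to G$, $i\in I$, such that the compositions $j_i\iota_i:H\to G$ are all equal. *)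

(* Defs.v *)
From HB Require Import structures.
From mathcomp Require Import all_boot.
From mathcomp Require Import boolp classical_sets topology.

Set Implicit Arguments.
Unset Strict Implicit.
Unset Printing Implicit Defensive.

Local Open Scope classical_set_scope.
Local Open Scope group_scope.

HB.mixin Record Group_isTopologicalGroup G of Group G & Topological G := {
  mulg_continuous : continuous (fun xy : G * G => xy.1 * xy.2) ;
  invg_continuous : continuous (fun x : G => x^-1)
}.

#[short(type="topologicalGroupType")]
HB.structure Definition TopologicalGroup :=
  {G of Group G & Topological G & Group_isTopologicalGroup G}.

HB.mixin Record TopologicalGroup_isCompactGroup G of TopologicalGroup G := {
  group_compact : compact [set: G] ;
  group_hausdorff : hausdorff_space G
}.

#[short(type="compactGroupType")]
HB.structure Definition CompactGroup :=
  {G of TopologicalGroup G & TopologicalGroup_isCompactGroup G}.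

Definition group_hom (G K : groupType) (f : G -> K) : Prop :=
  {morph f : x y / x * y}.

Definition continuous_hom (G K : compactGroupType) (f : G -> K) : Prop :=
  group_hom f /\ continuous f.

Definition embedding (G K : compactGroupType) (f : G -> K) : Prop :=
  continuous_hom f /\ injective f.

Definition normal_subgroup (G : groupType) (N : set G) : Prop :=
  [/\ N 1,
      forall x y, N x -> N y -> N (x * y),
      forall x, N x -> N x^-1
    & forall x g, N x -> N (x ^ g)].

(* A cocone under the diagram formed by the iota i has a leg at every vertex,
   including H; the leg at H is redundant unless I is empty. *)
Definition is_cocone (H : Type) (I : Type) (G : I -> Type)
    (iota : forall i, H -> G i) (K : Type)
    (kH : H -> K) (k : forall i, G i -> K) : Prop :=
  forall i x, k i (iota i x) = kH x.

(* u is a map of cocones from (p_H, p) to (k_H, k) *)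
Definition is_cocone_map (H : Type) (I : Type) (G : I -> Type) (P K : Type)
    (pH : H -> P) (p : forall i, G i -> P)
    (kH : H -> K) (k : forall i, G i -> K) (u : P -> K) : Prop :=
  (forall x, u (pH x) = kH x) /\ (forall i x, u (p i x) = k i x).

Definition group_cocone (H : groupType) (I : Type) (G : I -> groupType)
    (iota : forall i, H -> G i) (K : groupType)
    (kH : H -> K) (k : forall i, G i -> K) : Prop :=
  [/\ group_hom kH, forall i, group_hom (k i) & is_cocone iota kH k].

Definition compact_group_cocone (H : compactGroupType) (I : Type)
    (G : I -> compactGroupType) (iota : forall i, H -> G i)
    (K : compactGroupType) (kH : H -> K) (k : forall i, G i -> K) : Prop :=
  [/\ continuous_hom kH, forall i, continuous_hom (k i) & is_cocone iota kH k].

Definition is_group_multipushout (H : groupType) (I : Type)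
    (G : I -> groupType) (iota : forall i, H -> G i) (P : groupType)
    (pH : H -> P) (p : forall i, G i -> P) : Prop :=
  group_cocone iota pH p /\
  forall (K : groupType) (kH : H -> K) (k : forall i, G i -> K),
    group_cocone iota kH k ->
    exists! u : P -> K, group_hom u /\ is_cocone_map pH p kH k u.

Definition is_compact_group_multipushout (H : compactGroupType) (I : Type)
    (G : I -> compactGroupType) (iota : forall i, H -> G i)
    (Q : compactGroupType) (qH : H -> Q) (q : forall i, G i -> Q) : Prop :=
  compact_group_cocone iota qH q /\
  forall (K : compactGroupType) (kH : H -> K) (k : forall i, G i -> K),
    compact_group_cocone iota kH k ->
    exists! u : Q -> K, continuous_hom u /\ is_cocone_map qH q kH k u.

(* P and Q are the two multi-pushouts and c is the canonical homomorphism
   between them. Both colimits are unique up to a unique isomorphism, so the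
   choice of P, Q is immaterial; stating the definition existentially makes the
   existence of the colimits part of it, rather than letting it hold vacuously
   in their absence. *)
Definition algebraically_sound (H : compactGroupType) (I : Type)
    (G : I -> compactGroupType) (iota : forall i, H -> G i) : Prop :=
  exists (P : groupType) (pH : H -> P) (p : forall i, G i -> P)
         (Q : compactGroupType) (qH : H -> Q) (q : forall i, G i -> Q)
         (c : P -> Q),
    [/\ is_group_multipushout iota pH p,
        is_compact_group_multipushout iota qH q,
        group_hom c /\ is_cocone_map pH p qH q c
      & injective c].

Definition coherently_embeddable (H : compactGroupType) (I : Type)
    (G : I -> compactGroupType) (iota : forall i, H -> G i) : Prop :=
  exists (K : compactGroupType) (j : forall i, G i -> K),
    (forall i, embedding (j i)) /\
    (forall i i' x, j i (iota i x) = j i' (iota i' x)).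

(* Main.v *)
(* If the family is algebraically sound, the structure maps of the compact
   multi-pushout are injective, because each G_i embeds in the abstract one:
   all the G_i act, compatibly on H, on the set H * Y for a large enough Y.

   Conversely, the canonical homomorphism is injective as soon as every x <> 1 in
   the abstract multi-pushout is moved by some cocone of compact groups. Now x is
   the image of an element of H times a reduced word in letters outside H. If the
   word is empty, the given coherent embedding detects x. Otherwise, as H is normal,
   the Peter-Weyl theorem provides for each letter an orthogonal representation of
   G_i that is trivial on H, and in which the letter has a nonzero off-diagonal
   entry (s, t). Gluing these representations along a chain, vector s of one letter
   to vector t of the next, yields a single orthogonal representation in which the
   word sends the first vector of the chain to a vector with a nonzero component
   along the last one.

   For the Peter-Weyl theorem, the invariant mean of f is the constant that is a
   uniform limit of averages of translates of f, and the representations are the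
   eigenspaces of the square of the convolution by an autocorrelation function. *)
From HB Require Import structures.
From mathcomp Require Import all_boot all_order all_algebra finmap ring lra.
From mathcomp Require Import generic_quotient.
From mathcomp Require Import all_classical all_reals topology normedtype urysohn Rstruct.
Require Import Defs.

Set Implicit Arguments.
Unset Strict Implicit.
Unset Printing Implicit Defensive.

Import Order.TTheory GRing.Theory Num.Theory.
Import numFieldNormedType.Exports.

Local Open Scope classical_set_scope.
Local Open Scope ring_scope.

(** * Continuity and compactness *)

(** Representations trivial on H always form a cocone, so normality lets the groups [G i] be treated
    independently of each other. Two obstacles shape the gluing. A representation matrix other than
    1 may be diagonal, such as -1; it is therefore summed with a trivial representation and written
    in a rotated basis, where A - 1 shows up off the diagonal. And a group may occur in several
    letters of a word, so at each gluing it carries an old and a new action, which must commute: the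
    new one moves only the glued subspace, and the old one fixes the glued vector because
    neighbouring letters come from different groups.

    The analysis stays among continuous functions: Arzela-Ascoli produces the eigenvectors as
    uniform limits. Maximizing the norm of a self-adjoint operator leads directly to an eigenvector
    of its square, whatever the sign of the eigenvalue.

    Both colimits quantify over all groups, yet need small carriers: they are quotients of words,
    respectively of filters, by relations valued in [Prop]. *)

Lemma eq_eps {R : realType} (x y : R) : (forall e : R, 0 < e -> `|x - y| <= e) -> x = y.
Proof.
move=> h; apply/eqP; rewrite -subr_eq0 -normr_le0 leNgt; apply/negP => d0.
by have := h (`|x - y| / 2) ltac:(lra); lra.
Qed.

Lemma norm_le_sqr {R : realType} (x c : R) : 0 <= c -> x ^+ 2 <= c ^+ 2 -> `|x| <= c.
Proof. by move=> c0 h; rewrite ler_norml; apply/andP; split; nra. Qed.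

Lemma ultra_lim (P : Type) (K : topologicalType) (F : set_system P) (A : set K)
    (u : P -> K) : UltraFilter F -> compact A -> (forall p, A (u p)) ->
  exists l : K, u @ F --> l.
Proof.
move=> FU cA Au; have FP : ProperFilter F by exact: ultra_proper.
have [|l [Al cl]] := cA (u @ F) (fmap_proper_filter _ _).
  exact: (filterE _ Au).
exists l => B nB.
have [//|FnB] := in_ultra_setVsetC (u @^-1` B) FU.
by have [y [/= nBy By]] := cl (~` B) B FnB nB.
Qed.

Lemma cluster_continuous (X Y : topologicalType) (f : X -> Y) p q :
  hausdorff_space Y -> continuous f -> cluster (nbhs p) q -> f p = f q.
Proof.
move=> hY cf cpq; apply: hY => A B nA nB.
by have [x [Ax Bx]] := cpq _ _ (cf p A nA) (cf q B nB); exists (f x).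
Qed.

Lemma tube {R : realType} (X Y : topologicalType) (F : X -> Y -> R) (x0 : X) (e : R) :
  compact [set: Y] -> continuous (fun xy => F xy.1 xy.2) -> 0 < e ->
  \forall x \near x0, forall y, `|F x y - F x0 y| < e.
Proof.
move=> cY0 cF e0; have cY := (compact_near_coveringP _).1 cY0.
suff near_y : forall y, [set: Y] y ->
    \forall y' \near y & x \near nbhs x0, `|F x y' - F x0 y'| < e.
  have near_x := cY X (nbhs x0) (fun x y => `|F x y - F x0 y| < e) (nbhs_filter x0) near_y.
  by apply: filterS near_x => x h y; exact: (h y Logic.I).
move=> y _.
have h : \forall z \near (x0, y), `|F x0 y - F z.1 z.2| < e / 2.
  by have /cvgrPdist_lt/(_ (e / 2)) := cF (x0, y); apply; rewrite divr_gt0.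
case: h => -[A B] /= [Ax0 By] AB; exists (B, A) => //= -[y' x'] /= [By' Ax'].
have h1 := AB (x', y') (conj Ax' By').
have h2 := AB (x0, y') (conj (nbhs_singleton Ax0) By').
rewrite /= in h1 h2; rewrite -(subrKA (F x0 y)) (splitr e).
by apply: (le_lt_trans (ler_normD _ _)); rewrite ltrD // distrC.
Qed.

Lemma cts_comp (X Y Z : topologicalType) (f : X -> Y) (g : Y -> Z) :
  continuous f -> continuous g -> continuous (fun x => g (f x)).
Proof.
by move=> cf cg x; apply: (@continuous_comp _ _ _ f g); [exact: cf|exact: cg].
Qed.

Lemma eq_cts {X Y : topologicalType} (g f : X -> Y) :
  (forall x, f x = g x) -> continuous g -> continuous f.
Proof. by move=> /funext ->. Qed.

Lemma cts_section {X Y Z : topologicalType} (F : X -> Y -> Z) x :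
  continuous (fun xy => F xy.1 xy.2) -> continuous (F x).
Proof.
move=> cF; apply: (@cts_comp _ _ _ (fun y => (x, y)) _ _ cF) => y.
by apply: cvg_pair; [exact: cvg_cst|exact: cvg_id].
Qed.

Lemma cts_section2 {X Y Z : topologicalType} (F : X -> Y -> Z) y :
  continuous (fun xy => F xy.1 xy.2) -> continuous (F^~ y).
Proof.
move=> cF; apply: (@cts_comp _ _ _ (fun x => (x, y)) _ _ cF) => x.
by apply: cvg_pair; [exact: cvg_id|exact: cvg_cst].
Qed.

Section group_continuity.
Context {G : topologicalGroupType}.

Lemma cts_mulg (X : topologicalType) (f g : X -> G) :
  continuous f -> continuous g -> continuous (fun x => f x * g x)%g.
Proof.
move=> cf cg x; apply: (@continuous_comp _ _ _ (fun x => (f x, g x))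
  (fun xy => xy.1 * xy.2)%g); last exact: (@mulg_continuous G).
by apply: cvg_pair; [exact: cf|exact: cg].
Qed.

Lemma cts_invg (X : topologicalType) (f : X -> G) :
  continuous f -> continuous (fun x => (f x)^-1)%g.
Proof.
move=> cf x; apply: (@continuous_comp _ _ _ f (fun x => x^-1)%g); first exact: cf.
exact: (@invg_continuous G).
Qed.

Lemma cts_mull (a : G) : continuous (fun x => a * x)%g.
Proof.
apply: (@cts_mulg _ (fun=> a) id); first exact: cst_continuous.
by move=> x; exact: cvg_id.
Qed.

Lemma cts_mulr (a : G) : continuous (fun x => x * a)%g.
Proof.
apply: (@cts_mulg _ id (fun=> a)); last exact: cst_continuous.
by move=> x; exact: cvg_id.
Qed.

End group_continuity.

Lemma compactG (G : compactGroupType) : compact [set: G].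
Proof. exact: group_compact. Qed.

Lemma hausdorffG (K : compactGroupType) : hausdorff_space K.
Proof. exact: group_hausdorff. Qed.

Lemma finite_net {G : compactGroupType} (P : G -> G -> Prop) :
  (forall a, \forall x \near a, P a x) ->
  exists2 s : seq G, (0 < size s)%N & forall x, exists2 a, a \in s & P a x.
Proof.
move=> nP; have := @compactG G.
(* [compact_cover] speaks of pointed spaces; 1 serves as the point. *)
pose pG : ptopologicalType :=
  HB.pack_for ptopologicalType (TopologicalGroup.sort G) (isPointed.Build G 1%g).
rewrite (@compact_cover pG).
move=> /(_ G [set: G] (fun a => interior [set x | P a x])).
case.
- by move=> i _; exact: open_interior.
- by move=> x _; exists x => //; exact: nP.
move=> D _ Dc; exists (1%g :: D) => // x.
have [a aD /= /interior_subset /= Va] := Dc x Logic.I.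
by exists a => //; rewrite in_cons; apply/orP; right.
Qed.

Lemma finite_translates {G : compactGroupType} (V : set G) : nbhs 1%g V ->
  exists2 s : seq G, (0 < size s)%N & forall x, exists2 a, a \in s & V (x * a)%g.
Proof.
move=> V1; have [|s s0 sP] := @finite_net G (fun a x => V (x * a^-1)%g).
  by move=> a; apply: (@cts_mulr G (a^-1)%g a); rewrite mulgV.
exists [seq a^-1%g | a <- s]; first by rewrite size_map.
move=> x; have [a a_s Vxa] := sP x; exists (a^-1)%g => //.
by apply/mapP; exists a.
Qed.

Lemma cts_bounded {R : realType} (X : topologicalType) (f : X -> R) :
  compact [set: X] -> continuous f -> exists2 B : R, 0 < B & forall x, `|f x| <= B.
Proof.
move=> cX cf; have /compact_bounded := continuous_compact (continuous_subspaceT cf) cX.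
move=> /pinfty_ex_gt0 [B B0 hB]; exists B => // x.
by apply: hB; exists x.
Qed.

Lemma cvg_sumr {R : realType} (T I : Type) (F : set_system T) (s : seq I) (P : pred I)
    (f : I -> T -> R) (l : I -> R) : Filter F -> (forall i, f i @ F --> l i) ->
  (fun x => \sum_(i <- s | P i) f i x) @ F --> \sum_(i <- s | P i) l i.
Proof.
move=> FF fl; elim: s => [|i s IH].
  have -> : (fun x => \sum_(i <- [::] | P i) f i x) = (fun=> 0).
    by apply/funext => x; rewrite big_nil.
  by rewrite big_nil; exact: cvg_cst.
have -> : (fun x => \sum_(j <- i :: s | P j) f j x) =
          (fun x => (if P i then f i x else 0) + \sum_(j <- s | P j) f j x).
  by apply/funext => x; rewrite big_cons; case: (P i) => //; rewrite add0r.
have -> : \sum_(j <- i :: s | P j) l j =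
          (if P i then l i else 0) + \sum_(j <- s | P j) l j.
  by rewrite big_cons; case: (P i) => //; rewrite add0r.
by apply: cvgD IH; case: (P i); [exact: fl|exact: cvg_cst].
Qed.

Section real_continuity.
Context {R : realType} {X : topologicalType}.
Implicit Types f g : X -> R.

Lemma cts_add f g : continuous f -> continuous g -> continuous (fun x => f x + g x).
Proof. by move=> cf cg x; apply: cvgD; [exact: cf|exact: cg]. Qed.

Lemma cts_opp f : continuous f -> continuous (fun x => - f x).
Proof. by move=> cf x; apply: cvgN; exact: cf. Qed.

Lemma cts_sub f g : continuous f -> continuous g -> continuous (fun x => f x - g x).
Proof. by move=> cf cg; apply: cts_add => //; exact: cts_opp. Qed.

Lemma cts_mul f g : continuous f -> continuous g -> continuous (fun x => f x * g x).
Proof. by move=> cf cg x; apply: cvgM; [exact: cf|exact: cg]. Qed.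

Lemma cts_cst (c : R) : continuous (fun _ : X => c).
Proof. exact: cst_continuous. Qed.

Lemma cts_sum (I : Type) (s : seq I) (P : pred I) (F : I -> X -> R) :
  (forall i, continuous (F i)) -> continuous (fun x => \sum_(i <- s | P i) F i x).
Proof.
by move=> cF x; apply: cvg_sumr => i; exact: cF.
Qed.

End real_continuity.

(** * The invariant mean of a compact group *)

Section average.
Context {R : realType} {T : eqType}.
Implicit Types (s : seq T) (F : T -> R).

Definition avg s F : R := (size s)%:R^-1 * \sum_(a <- s) F a.

Lemma avg_cst s c : (0 < size s)%N -> avg s (fun=> c) = c.
Proof.
move=> s0; rewrite /avg big_const_seq count_predT iter_addr_0 -[c *+ _]mulr_natl mulKf //.
by rewrite pnatr_eq0 -lt0n.
Qed.

Lemma ler_avg s F F' : (forall a, a \in s -> F a <= F' a) -> avg s F <= avg s F'.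
Proof. by move=> h; rewrite ler_wpM2l ?invr_ge0 ?ler0n// big_seq [leRHS]big_seq ler_sum. Qed.

Lemma avgD s F F' : avg s (fun a => F a + F' a) = avg s F + avg s F'.
Proof. by rewrite /avg big_split mulrDr. Qed.

Lemma avgB s F F' : avg s (fun a => F a - F' a) = avg s F - avg s F'.
Proof. by rewrite /avg sumrB mulrBr. Qed.

Lemma avgZ s c F : avg s (fun a => c * F a) = c * avg s F.
Proof. by rewrite /avg -mulr_sumr mulrCA. Qed.

Lemma avg_dist s F (c e : R) : (0 < size s)%N ->
  (forall a, `|F a - c| <= e) -> `|avg s F - c| <= e.
Proof.
move=> s0 h; rewrite -[c in X in X <= _](avg_cst c s0) -avgB ler_norml.
rewrite -[X in X <= _](avg_cst (- e) s0) -[X in _ && (_ <= X)](avg_cst e s0).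
by apply/andP; split; apply: ler_avg => a _; have := h a; rewrite ler_norml => /andP[].
Qed.

Lemma avg_drop s F (c d : R) k : k \in s -> (forall a, F a <= c) -> F k <= c - d ->
  avg s F <= c - d / (size s)%:R.
Proof.
move=> ks Fc Fk; have s0 : (0 < size s)%N by case: s ks.
rewrite -[X in X - _](avg_cst c s0) lerBrDr -lerBrDl -avgB /avg mulrC.
rewrite ler_pM2l ?invr_gt0 ?ltr0n//.
have : d <= c - F k by lra.
move/le_trans; apply; elim: s ks {s0} => // b s IH; rewrite in_cons big_cons.
have pos : 0 <= \sum_(a <- s) (c - F a) by rewrite sumr_ge0 // => a _; rewrite subr_ge0.
by case/orP => [/eqP <-|/IH h]; [rewrite lerDl|have := Fc b; lra].
Qed.

End average.

Lemma avg_exchange {R : realType} (T U : eqType) s t (F : T -> U -> R) :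
  avg s (fun a => avg t (F a)) = avg t (fun b => avg s (F^~ b)).
Proof. by rewrite /avg -!mulr_sumr exchange_big /= mulrCA. Qed.

Lemma avg_map {R : realType} (T U : eqType) s (h : T -> U) (F : U -> R) :
  avg (map h s) F = avg s (fun a => F (h a)).
Proof. by rewrite /avg size_map big_map. Qed.

Lemma avg_allpairs {R : realType} (T U V : eqType) s t (h : T -> U -> V) (F : V -> R) :
  avg [seq h a b | a <- s, b <- t] F = avg s (fun a => avg t (fun b => F (h a b))).
Proof.
by rewrite /avg size_allpairs natrM invfM -mulr_sumr mulrA big_allpairs_dep.
Qed.

Section mean.
Context {R : realType} {G : compactGroupType}.
Implicit Types (f g : G -> R) (s : seq G).

Definition ravg s f x : R := avg s (fun a => f (x * a)%g).
Definition lavg s f x : R := avg s (fun a => f (a * x)%g).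

Definition rmean f c := forall e : R, 0 < e ->
  exists2 s, (0 < size s)%N & forall x, `|ravg s f x - c| <= e.
Definition lmean f c := forall e : R, 0 < e ->
  exists2 s, (0 < size s)%N & forall x, `|lavg s f x - c| <= e.

Lemma ravg_ravg s t f x :
  ravg s (ravg t f) x = ravg [seq (a * b)%g | a <- s, b <- t] f x.
Proof.
rewrite /ravg avg_allpairs; congr (avg _ _).
by apply/funext => a; congr (avg _ _); apply/funext => b; rewrite mulgA.
Qed.

Lemma lavg_ravg s t f x : lavg s (ravg t f) x = ravg t (lavg s f) x.
Proof.
rewrite /lavg /ravg avg_exchange; congr (avg _ _); apply/funext => b.
by congr (avg _ _); apply/funext => a; rewrite mulgA.
Qed.

Lemma rmean_exists f : continuous f -> exists c, rmean f c.
Proof.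
move=> cf; have [B B0 fB] := cts_bounded (@compactG G) cf.
pose A := [set t | exists2 s, (0 < size s)%N & forall x, ravg s f x <= t].
have lbA : lbound A (- B).
  move=> t [s s0 hs]; apply: le_trans (hs 1%g); rewrite -(avg_cst (- B) s0).
  by apply: ler_avg => a _; rewrite lerNl; apply: le_trans (fB (1 * a)%g); rewrite -normrN ler_norm.
have iA : has_inf A.
  split; last by exists (- B).
  exists B; exists [:: 1%g] => // x; rewrite -(@avg_cst _ _ [:: 1%g : G] B) //.
  by apply: ler_avg => a _; apply: le_trans (ler_norm _) (fB _).
(* If some average of f, everywhere below [inf A + small], were below [inf A - e]
   at x, averaging it further over translates moving every point close to x would
   push its maximum below [inf A]. *)
exists (inf A) => e e0; have e20 : 0 < e / 2 by lra.
have nV : \forall v \near (1 : G)%g, forall y, `|f (v * y)%g - f (1 * y)%g| < e / 2.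
  apply: (@tube R G G (fun v y => f (v * y)%g)) => //; first exact: compactG.
  by apply: cts_comp cf; exact: mulg_continuous.
have [c c0 cV] := finite_translates nV.
have cn0 : 0 < (size c)%:R :> R by rewrite ltr0n.
(* The slack is half of the drop that one value lower by e / 2 causes in an average over [c]. *)
have d0 : 0 < (e / 2) / (size c)%:R / 2 by rewrite !divr_gt0.
have [t [s s0 st] tA] := inf_adherent d0 iA.
exists s => // x; rewrite ler_norml; apply/andP; split; last first.
  have : (e / 2) / (size c)%:R / 2 <= e.
    have : (e / 2) / (size c)%:R <= (e / 2).
      by rewrite ler_pdivrMr // ler_peMr ?ler1n// ltW.
    by lra.
  by have := st x; lra.
rewrite leNgt; apply/negP => hx.
suff /(ge_inf iA.2) : A (t - (e / 2) / (size c)%:R) by lra.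
exists [seq (a * b)%g | a <- [seq (k * x)%g | k <- c], b <- s].
  by rewrite size_allpairs size_map muln_gt0 c0.
move=> y; rewrite -ravg_ravg /ravg avg_map.
have [k kc /= kV] := cV y.
apply: (@avg_drop _ _ _ _ _ _ k) => //.
  by move=> a; exact: st.
apply: (@le_trans _ _ (ravg s f x + e / 2)); last first.
  by have : inf A <= t by [apply: (ge_inf iA.2); exists s]; lra.
rewrite -[X in _ + X](avg_cst (e / 2) s0) -avgD; apply: ler_avg => a _.
have := kV (x * a)%g; rewrite mul1g !mulgA ltr_norml => /andP[_]; lra.
Qed.

Lemma lmean_exists f : continuous f -> exists c, lmean f c.
Proof.
move=> cf; have [|c hc] := @rmean_exists (fun x => f x^-1%g).
  by apply: cts_comp cf; exact: invg_continuous.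
exists c => e e0; have [s s0 hs] := hc e e0.
exists (map (fun x => x^-1)%g s); first by rewrite size_map.
move=> x; have := hs x^-1%g; rewrite /ravg /lavg avg_map.
by under eq_fun do rewrite invgM invgK.
Qed.

(** Left and right averaging commute, so averaging on both sides gives one number close to both
    constants. This yields at once uniqueness and two-sided invariance of the mean. *)
Lemma rmean_lmean f c c' : rmean f c -> lmean f c' -> c = c'.
Proof.
move=> hc hc'; apply: eq_eps => e e0.
have [s s0 hs] := hc (e / 2) ltac:(lra); have [t t0 ht] := hc' (e / 2) ltac:(lra).
have h1 := @avg_dist _ _ t _ c (e / 2) t0 (fun a => hs (a * 1)%g).
have h2 := @avg_dist _ _ s _ c' (e / 2) s0 (fun a => ht (1 * a)%g).
have := lavg_ravg t s f 1%g; rewrite /lavg /ravg in h1 h2 * => E.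
rewrite E distrC in h1; apply: le_trans (ler_distD _ _ _) _; last first.
  by apply: (le_trans (lerD h1 h2)); lra.
Qed.

Definition mean f : R := xget 0 [set c | rmean f c].

Lemma rmeanP f : continuous f -> rmean f (mean f).
Proof. by move=> /rmean_exists h; exact: (xgetPex 0 h). Qed.

Lemma lmeanP f : continuous f -> lmean f (mean f).
Proof.
by move=> cf; have [c hc] := lmean_exists cf; rewrite (rmean_lmean (rmeanP cf) hc).
Qed.

Lemma mean_eqr f c : continuous f -> rmean f c -> mean f = c.
Proof. by move=> cf hc; rewrite (rmean_lmean hc (lmeanP cf)). Qed.

Lemma mean_eql f c : continuous f -> lmean f c -> mean f = c.
Proof. by move=> cf hc; rewrite (rmean_lmean (rmeanP cf) hc). Qed.

Lemma mean_dist f (c e : R) : continuous f -> (forall x, `|f x - c| <= e) -> `|mean f - c| <= e.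
Proof.
move=> cf h; apply/ler_addgt0Pl => d d0; have [s s0 hs] := rmeanP cf d0.
rewrite -(subrKA (ravg s f 1%g)); apply: le_trans (ler_normD _ _) _.
by apply: lerD; [rewrite distrC|exact: avg_dist].
Qed.

Lemma mean_ge f c : continuous f -> (forall x, c <= f x) -> c <= mean f.
Proof.
move=> cf h; apply/ler_addgt0Pl => d d0; have [s s0 hs] := rmeanP cf d0.
have : c <= ravg s f 1%g by rewrite -[leLHS](avg_cst c s0); apply: ler_avg.
by have := hs 1%g; rewrite ler_norml => /andP[]; lra.
Qed.

Lemma mean_cst c : mean (fun=> c) = c.
Proof.
apply: eq_eps => e e0; apply: mean_dist; first exact: cst_continuous.
by move=> x; rewrite subrr normr0 ltW.
Qed.

Lemma ravg_continuous s f : continuous f -> continuous (ravg s f).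
Proof.
move=> cf; apply: cts_mul; first exact: cts_cst.
by apply: cts_sum => a; apply: cts_comp cf; exact: cts_mulr.
Qed.

Lemma mean_ravg s f : (0 < size s)%N -> continuous f -> mean (ravg s f) = mean f.
Proof.
move=> s0 cf; apply: mean_eql; first exact: ravg_continuous.
move=> e e0; have [t t0 ht] := lmeanP cf e0; exists t => // x.
by rewrite lavg_ravg; apply: avg_dist.
Qed.

(** One list of translations has to flatten both functions: [s] flattens f, and then [t] flattens
    the [s]-average of g without spoiling what [s] did to f. *)
Lemma meanD f g : continuous f -> continuous g ->
  mean (fun x => f x + g x) = mean f + mean g.
Proof.
move=> cf cg; have cfg := cts_add cf cg.
apply: eq_eps => e e0.
have [s s0 hs] := rmeanP cf (e := e / 2) ltac:(lra).
have [t t0 ht] := rmeanP (@ravg_continuous s _ cg) (e := e / 2) ltac:(lra).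
rewrite -(mean_ravg s0 cfg) -(mean_ravg t0 (@ravg_continuous s _ cfg)).
apply: mean_dist; first by do 2 apply: ravg_continuous.
move=> x; have -> : ravg t (ravg s (fun y => f y + g y)) x =
   ravg t (ravg s f) x + ravg t (ravg s g) x.
  by rewrite /ravg -avgD; under [in LHS]eq_fun do rewrite avgD.
rewrite opprD addrACA (splitr e); apply: le_trans (ler_normD _ _) _.
apply: lerD; first by apply: avg_dist.
by rewrite -(mean_ravg s0 cg).
Qed.

Lemma meanZ c f : continuous f -> mean (fun x => c * f x) = c * mean f.
Proof.
move=> cf; apply: mean_eqr.
  by apply: cts_mul => //; exact: cts_cst.
move=> e e0; have d0 : 0 < e / (`|c| + 1) by rewrite divr_gt0 // ltr_wpDl.
have [s s0 hs] := rmeanP cf d0; exists s => // x.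
rewrite /ravg avgZ -mulrBr normrM; apply: (@le_trans _ _ ((`|c| + 1) * (e / (`|c| + 1)))).
  by apply: ler_pM => //; [lra|exact: hs].
by rewrite mulrC divfK // gt_eqF // ltr_wpDl.
Qed.

Lemma mean_mull (g : G) f : continuous f -> mean (fun x => f (g * x)%g) = mean f.
Proof.
move=> cf; apply: mean_eqr; first by apply: (cts_comp _ cf); exact: cts_mull.
move=> e e0; have [s s0 hs] := rmeanP cf e0; exists s => // x.
by have := hs (g * x)%g; rewrite /ravg; under eq_fun do rewrite -mulgA.
Qed.

(** If f were positive at x0, it would be at least f x0 / 2 near x0. Finitely many translates of
    that neighbourhood cover the group, so an average of f is bounded below by a positive constant,
    and averaging preserves the mean. *)
Lemma mean_eq0 f : continuous f -> (forall x, 0 <= f x) -> mean f = 0 ->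
  forall x, f x = 0.
Proof.
move=> cf f0 mf x0; apply/eqP; rewrite eq_le f0 andbT leNgt; apply/negP => fx0.
have nV : \forall v \near (1 : G)%g, f x0 / 2 <= f (v * x0)%g.
  have c1 : {for (1 : G)%g, continuous (fun v => f (v * x0)%g)}.
    by apply: (cts_comp _ cf); exact: cts_mulr.
  have : f x0 / 2 < f (1 * x0)%g by rewrite mul1g; lra.
  by move=> /(cvgr_gt _ c1); apply: filterS => v /ltW.
have [c c0 cV] := finite_translates nV.
pose s := [seq (k * x0)%g | k <- c].
have s0 : (0 < size s)%N by rewrite size_map.
have : f x0 / 2 / (size s)%:R <= mean (ravg s f).
  apply: mean_ge; first exact: ravg_continuous.
  move=> y; have [k kc kV] := cV y; rewrite -lerN2.
  have -> : - ravg s f y = avg c (fun a => - f (y * (a * x0))%g).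
    by rewrite /ravg avg_map /avg -mulrN -sumrN.
  rewrite -[leRHS]add0r size_map; apply: (@avg_drop _ _ _ _ _ _ k) => //.
    by move=> a; rewrite oppr_le0.
  by rewrite add0r lerN2 mulgA.
rewrite mean_ravg // mf leNgt => /negP; apply.
by rewrite !divr_gt0 // ltr0n.
Qed.

End mean.

Section mean_parameter.
Context {R : realType} {G : compactGroupType}.

Lemma meanB (f g : G -> R) : continuous f -> continuous g ->
  mean (fun x => f x - g x) = mean f - mean g.
Proof.
move=> cf cg; rewrite meanD//; last exact: cts_opp.
congr (_ + _); rewrite -mulN1r -meanZ //; congr mean.
by apply/funext => x; rewrite mulN1r.
Qed.

Lemma ler_mean (f g : G -> R) : continuous f -> continuous g ->
  (forall x, f x <= g x) -> mean f <= mean g.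
Proof.
move=> cf cg h; rewrite -subr_ge0 -meanB //; apply: mean_ge; first exact: cts_sub.
by move=> x; rewrite subr_ge0.
Qed.

Lemma mean_le (f : G -> R) c : continuous f -> (forall x, f x <= c) -> mean f <= c.
Proof. by move=> cf h; rewrite -(@mean_cst R G c) ler_mean //; exact: cts_cst. Qed.

Lemma mean_sum (I : Type) (s : seq I) (F : I -> G -> R) :
  (forall i, continuous (F i)) ->
  mean (fun x => \sum_(i <- s) F i x) = \sum_(i <- s) mean (F i).
Proof.
move=> cF; elim: s => [|i s IH].
  rewrite big_nil -[RHS](@mean_cst R G 0); congr mean.
  by apply/funext => x; rewrite big_nil.
rewrite big_cons -IH -meanD //; last exact: cts_sum.
by congr mean; apply/funext => x; rewrite big_cons.
Qed.

Lemma mean_avg (I : eqType) (s : seq I) (F : I -> G -> R) :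
  (forall i, continuous (F i)) ->
  mean (fun x => avg s (F^~ x)) = avg s (fun i => mean (F i)).
Proof. by move=> cF; rewrite /avg meanZ ?mean_sum //; exact: cts_sum. Qed.

Lemma mean_param_cts (X : topologicalType) (F : X -> G -> R) :
  continuous (fun xy => F xy.1 xy.2) -> continuous (fun x => mean (F x)).
Proof.
move=> cF x; apply/cvgrPdist_le => e e0.
have := @tube R X G F x e (@compactG G) cF e0; apply: filterS => x' hx'.
rewrite distrC -meanB; do ?exact: cts_section.
rewrite -[X in `|X|]subr0; apply: mean_dist.
  by apply: cts_sub; exact: cts_section.
by move=> y; rewrite subr0 ltW.
Qed.

(** Averages are composed to serve a finite list of parameters, since a further average never spoils
    an earlier one; by compactness a finite net of parameters suffices. *)
Lemma uniform_rmean (F : G -> G -> R) (e : R) :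
  continuous (fun xy => F xy.1 xy.2) -> 0 < e ->
  exists2 s : seq G, (0 < size s)%N & forall x y, `|ravg s (F x) y - mean (F x)| <= e.
Proof.
move=> cF e0; have cFx x : continuous (F x) by exact: cts_section.
have fin (L : seq G) (d : R) : 0 < d -> exists2 s : seq G, (0 < size s)%N &
    forall x, x \in L -> forall y, `|ravg s (F x) y - mean (F x)| <= d.
  move=> d0; elim: L => [|a L [s s0 hs]]; first by exists [:: 1%g].
  have [t t0 ht] := rmeanP (@ravg_continuous _ _ s _ (cFx a)) d0.
  exists [seq (x * y)%g | x <- t, y <- s]; first by rewrite size_allpairs muln_gt0 t0.
  move=> x; rewrite in_cons => /orP[/eqP ->|xL] y; rewrite -ravg_ravg.
    by have := ht y; rewrite mean_ravg.
  by apply: avg_dist => // b; exact: hs.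
have e30 : 0 < e / 3 by lra.
have [L _ hL] := @finite_net G (fun a x => forall y, `|F x y - F a y| < e / 3)
  (fun a => @tube R G G F a (e / 3) (@compactG G) cF e30).
have [s s0 hs] := fin L (e / 3) e30; exists s => // x y.
have [a aL xa] := hL x; have h1 := hs a aL y.
have h2 : `|ravg s (F x) y - ravg s (F a) y| <= e / 3.
  rewrite /ravg -avgB -[X in `|X|]subr0; apply: avg_dist => // b.
  by rewrite subr0 ltW.
have h3 : `|mean (F a) - mean (F x)| <= e / 3.
  rewrite -meanB // -[X in `|X|]subr0; apply: mean_dist; first exact: cts_sub.
  by move=> b; rewrite subr0 distrC ltW.
move: h1 h2 h3; rewrite !ler_norml => /andP[? ?] /andP[? ?] /andP[? ?].
by apply/andP; split; lra.
Qed.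

(** The mean over x commutes with finite averages in y, and by [uniform_rmean] such averages
    approximate the inner mean uniformly in x. *)
Lemma mean_fubini (F : G -> G -> R) : continuous (fun xy => F xy.1 xy.2) ->
  mean (fun x => mean (F x)) = mean (fun y => mean (F^~ y)).
Proof.
move=> cF; have cFs : continuous (fun xy => F xy.2 xy.1).
  apply: (@cts_comp _ _ _ (fun xy : G * G => (xy.2, xy.1)) _ _ cF).
  exact: swap_continuous.
apply/esym/mean_eqr; first exact: (mean_param_cts (F := fun y x => F x y)).
move=> e e0; have [s s0 hs] := uniform_rmean cF e0; exists s => // y.
rewrite /ravg -(mean_avg _ (F := fun a x => F x (y * a)%g)); last first.
  by move=> a; exact: cts_section2.
have cr : continuous (fun x => avg s (fun a => F x (y * a)%g)).
  by apply: cts_mul; [exact: cts_cst|apply: cts_sum => a; exact: cts_section2].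
have cm : continuous (fun x => mean (F x)) by exact: mean_param_cts.
rewrite -meanB // -[X in `|X|]subr0; apply: mean_dist; first exact: cts_sub.
by move=> x; rewrite subr0; exact: hs.
Qed.

End mean_parameter.

(** * The pre-Hilbert space of continuous functions *)

Section cfun.
Context {R : realType} {G : compactGroupType}.

Definition continuousb : {pred G -> R} := fun f => `[< continuous f >].

Lemma continuousb_submod : submod_closed continuousb.
Proof.
split=> [|a f g]; rewrite !unfold_in; first by apply/asboolP; exact: cts_cst.
move=> /asboolP cf /asboolP cg; apply/asboolP; apply: (cts_add _ cg).
by apply: (cts_mul _ cf); exact: cts_cst.
Qed.

HB.instance Definition _ :=
  GRing.isSubmodClosed.Build R (G -> R) continuousb continuousb_submod.

Record cfun := CFun { cfun_val :> G -> R ; cfun_prop : cfun_val \in continuousb }.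

HB.instance Definition _ := [isSub for cfun_val].
HB.instance Definition _ := [Choice of cfun by <:].
HB.instance Definition _ := [SubChoice_isSubLmodule of cfun by <:].

Definition mk_cfun (f : G -> R) (cf : continuous f) : cfun :=
  CFun (asboolT cf).

Implicit Types f g h : cfun.

Lemma cfun_cts f : continuous f.
Proof. by case: f => f /= /asboolP. Qed.

Lemma cfunP f g : (forall x, f x = g x) -> f = g.
Proof. by move=> h; apply: val_inj; apply/funext => x; exact: h. Qed.

Lemma cfunD f g x : (f + g) x = f x + g x. Proof. by []. Qed.
Lemma cfunB f g x : (f - g) x = f x - g x. Proof. by []. Qed.
Lemma cfunZ a f x : (a *: f) x = a * f x. Proof. by []. Qed.
Lemma cfun0 x : (0 : cfun) x = 0. Proof. by []. Qed.

Lemma cfun_sum (I : Type) (s : seq I) (F : I -> cfun) x :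
  (\sum_(i <- s) F i) x = \sum_(i <- s) F i x.
Proof.
by elim: s => [|i s IH]; rewrite ?big_nil ?big_cons ?cfunD ?IH.
Qed.

Definition ip f g : R := mean (fun x => f x * g x).
Definition sqn f : R := ip f f.

Lemma cts_cfun_mul f g : continuous (fun x => f x * g x).
Proof. by apply: cts_mul; exact: cfun_cts. Qed.

Lemma ipC f g : ip f g = ip g f.
Proof. by congr mean; apply/funext => x; rewrite mulrC. Qed.

Lemma ipDl f g h : ip (f + g) h = ip f h + ip g h.
Proof.
rewrite -meanD; do ?exact: cts_cfun_mul.
by congr mean; apply/funext => x; rewrite cfunD mulrDl.
Qed.

Lemma ipZl a f g : ip (a *: f) g = a * ip f g.
Proof.
rewrite -meanZ; last exact: cts_cfun_mul.
by congr mean; apply/funext => x; rewrite cfunZ mulrA.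
Qed.

Lemma ipDr f g h : ip h (f + g) = ip h f + ip h g.
Proof. by rewrite ipC ipDl !(ipC h). Qed.

Lemma ipZr a f g : ip g (a *: f) = a * ip g f.
Proof. by rewrite ipC ipZl (ipC g). Qed.

Lemma ipNl f g : ip (- f) g = - ip f g.
Proof. by rewrite -scaleN1r ipZl mulN1r. Qed.

Lemma ipNr f g : ip f (- g) = - ip f g.
Proof. by rewrite ipC ipNl ipC. Qed.

Lemma ip0l f : ip 0 f = 0.
Proof. by rewrite -(scale0r (0 : cfun)) ipZl mul0r. Qed.

Lemma ip_suml (I : Type) (s : seq I) (F : I -> cfun) g :
  ip (\sum_(i <- s) F i) g = \sum_(i <- s) ip (F i) g.
Proof.
by elim: s => [|i s IH]; rewrite ?big_nil ?ip0l // !big_cons ipDl IH.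
Qed.

Lemma ip_sumr (I : Type) (s : seq I) (F : I -> cfun) g :
  ip g (\sum_(i <- s) F i) = \sum_(i <- s) ip g (F i).
Proof. by rewrite ipC ip_suml; apply: eq_bigr => i _; rewrite ipC. Qed.

Lemma sqn_ge0 f : 0 <= sqn f.
Proof. by apply: mean_ge; [exact: cts_cfun_mul|move=> x; rewrite -expr2 sqr_ge0]. Qed.

Lemma sqn_eq0 f : sqn f = 0 -> f = 0.
Proof.
move=> h; apply: cfunP => x; apply/eqP; rewrite cfun0 -sqrf_eq0 expr2; apply/eqP.
apply: (mean_eq0 _ _ h); first exact: cts_cfun_mul.
by move=> y; rewrite -expr2 sqr_ge0.
Qed.

Lemma sqnZ a f : sqn (a *: f) = a ^+ 2 * sqn f.
Proof. by rewrite /sqn ipZl ipZr mulrA expr2. Qed.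

Lemma sqnD f g : sqn (f + g) = sqn f + 2 * ip f g + sqn g.
Proof. by rewrite /sqn ipDl !ipDr (ipC g f); ring. Qed.

Lemma sqnB f g : sqn (f - g) = sqn f - 2 * ip f g + sqn g.
Proof. by rewrite /sqn ipDl !ipDr !ipNl !ipNr (ipC g f); ring. Qed.

Lemma sqnD_le f g : sqn (f + g) <= 2 * sqn f + 2 * sqn g.
Proof. by have := sqn_ge0 (f - g); rewrite sqnB sqnD; lra. Qed.

Lemma cauchy_schwarz f g : ip f g ^+ 2 <= sqn f * sqn g.
Proof.
have [/sqn_eq0 ->|f0] := eqVneq (sqn f) 0; first by rewrite ip0l expr0n mulr_ge0 ?sqn_ge0.
have fp : 0 < sqn f by rewrite lt_neqAle eq_sym f0 sqn_ge0.
have := sqn_ge0 (ip f g *: f - sqn f *: g).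
rewrite sqnB !sqnZ ipZl ipZr.
have -> : ip f g ^+ 2 * sqn f - 2 * (ip f g * (sqn f * ip f g)) + sqn f ^+ 2 * sqn g =
   sqn f * (sqn f * sqn g - ip f g ^+ 2) by ring.
by rewrite pmulr_rge0 // subr_ge0.
Qed.

Lemma sqn_le f (c : R) : (forall x, `|f x| <= c) -> sqn f <= c ^+ 2.
Proof.
move=> h; apply: mean_le => [|x]; first exact: cts_cfun_mul.
by rewrite -expr2 -real_normK ?num_real // lerXn2r // nnegrE // (le_trans _ (h x)).
Qed.

Definition orthonormal (m : nat) (b : 'I_m -> cfun) :=
  forall i j, ip (b i) (b j) = (i == j)%:R.

Lemma ip_orthonormal m (b : 'I_m -> cfun) (c : 'I_m -> R) i :
  orthonormal b -> ip (b i) (\sum_j c j *: b j) = c i.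
Proof.
move=> ob; rewrite ip_sumr (bigD1 i) //= ipZr ob eqxx mulr1 big1 ?addr0 // => j ji.
by rewrite ipZr ob eq_sym (negbTE ji) mulr0.
Qed.

Lemma bessel m (b : 'I_m -> cfun) f : orthonormal b ->
  \sum_i ip (b i) f ^+ 2 <= sqn f.
Proof.
move=> ob; have := sqn_ge0 (f - \sum_j ip (b j) f *: b j).
set p := \sum_j _; have h : ip p f = \sum_i ip (b i) f ^+ 2.
  by rewrite ip_suml; apply: eq_bigr => i _; rewrite ipZl expr2.
have h2 : sqn p = \sum_i ip (b i) f ^+ 2.
  rewrite /sqn {1}/p ip_suml; apply: eq_bigr => i _.
  by rewrite ipZl ip_orthonormal // expr2.
by rewrite sqnB ipC h h2; lra.
Qed.

(* A maximal orthonormal family spans. *)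
Lemma orthonormal_basis (E : cfun -> Prop) (M : nat) :
  (forall a f g, E f -> E g -> E (a *: f + g)) ->
  (forall m (b : 'I_m -> cfun), orthonormal b -> (forall i, E (b i)) -> (m <= M)%N) ->
  exists m (b : 'I_m -> cfun), [/\ orthonormal b, forall i, E (b i) &
    forall f, E f -> f = \sum_i ip (b i) f *: b i].
Proof.
move=> Elin bound; pose P m := `[< exists b : 'I_m -> cfun,
  orthonormal b /\ forall i, E (b i) >].
have P0 : exists m, P m.
  by exists 0%N; apply/asboolP; exists (fun=> 0); split; case.
have PM m : P m -> (m <= M)%N by move=> /asboolP [b [ob Eb]]; exact: (bound m b).
case: (ex_maxnP P0 PM) => m /asboolP [b [ob Eb]] mmax; exists m, b; split=> // f Ef.
pose h := f - \sum_i ip (b i) f *: b i.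
have hb i : ip (b i) h = 0 by rewrite ipDr ipNr ip_orthonormal // subrr.
have Eh : E h.
  have Esum (s : seq 'I_m) : E (f - \sum_(i <- s) ip (b i) f *: b i).
    elim: s => [|i s IH]; first by rewrite big_nil subr0.
    by rewrite big_cons opprD addrCA -scaleNr; exact: Elin.
  exact: Esum.
apply/eqP; rewrite -subr_eq0; apply/eqP; rewrite -/h; apply: sqn_eq0; apply/eqP.
apply: contraTT (leqnn m) => h0; rewrite -ltnNge; apply: mmax; apply/asboolP.
have hp : 0 < sqn h by rewrite lt_neqAle eq_sym h0 sqn_ge0.
pose c := (Num.sqrt (sqn h))^-1.
have ch : sqn (c *: h) = 1.
  by rewrite sqnZ exprVn sqr_sqrtr ?mulVf ?sqn_ge0.
have E0 : E 0 by rewrite -(subrr f) addrC -scaleN1r; exact: Elin.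
(* Index 0 carries the normalized remainder, the other indices the old family. *)
exists (fun i => if unlift ord0 i is Some j then b j else c *: h); split=> [i j|i].
  case: unliftP => [i'|] ->; case: unliftP => [j'|] ->.
  - by rewrite ob (inj_eq lift_inj).
  - by rewrite ipZr hb mulr0.
  - by rewrite ipZl ipC hb mulr0.
  - by rewrite -[LHS]/(sqn _) ch eqxx.
case: unliftP => [i'|] _; first exact: Eb.
by rewrite -[_ *: _]addr0; exact: Elin.
Qed.

End cfun.
Arguments cfun : clear implicits.

(** * Symmetric kernel operators *)

(** The limit function is the pointwise limit along one nonprincipal ultrafilter on the integers.
    Equicontinuity and a finite net make the approximation uniform, for some index beyond any given
    [N]. *)
Lemma arzela {R : realType} {G : compactGroupType} (f_ : nat -> G -> R) (B : R) :
  (forall n x, `|f_ n x| <= B) ->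
  (forall x (e : R), 0 < e -> \forall x' \near x, forall n, `|f_ n x' - f_ n x| <= e) ->
  exists2 g : G -> R, continuous g &
    forall (e : R) (N : nat), 0 < e -> exists2 n, (N <= n)%N & forall x, `|f_ n x - g x| <= e.
Proof.
move=> fB ef; have [U [UU oU]] := ultraFilterLemma (T := nat) (F := \oo) _.
have UP : ProperFilter U by exact: ultra_proper.
have lim x : exists l : R, (fun n => f_ n x) @ U --> l.
  apply: (@ultra_lim _ _ _ `[- B, B] (fun n => f_ n x)) => //; first exact: segment_compact.
  by move=> n; rewrite /= in_itv /= -ler_norml.
have {lim} [g hg] := choice lim.
have gnear x (e : R) : 0 < e -> \forall n \near U, `|f_ n x - g x| <= e.
  move=> e0; have /cvgrPdist_le/(_ e e0) := hg x.
  by apply: filterS => n; rewrite distrC.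
have geq x x' (e : R) : (forall n, `|f_ n x' - f_ n x| <= e) -> `|g x' - g x| <= e.
  move=> h; apply/ler_addgt0Pl => d d0; have d20 : 0 < d / 2 by lra.
  have [n [h1 h2]] := filter_ex (filterI (gnear x (d / 2) d20) (gnear x' (d / 2) d20)).
  have := h n; move: h1 h2; rewrite /= !ler_norml.
  by move=> /andP[? ?] /andP[? ?] /andP[? ?]; apply/andP; split; lra.
exists g.
  move=> x; apply/cvgrPdist_le => e e0; have := ef x e e0.
  by apply: filterS => x' h; rewrite distrC; exact: geq.
move=> e N e0; have e30 : 0 < e / 3 by lra.
have [L _ hL] := @finite_net G (fun a x => forall n, `|f_ n x - f_ n a| <= e / 3)
  (fun a => ef a (e / 3) e30).
have : \forall n \near U, forall a, a \in L -> `|f_ n a - g a| <= e / 3.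
  elim: L {hL} => [|a L IH]; first exact: filterE.
  move: (gnear a _ e30) IH; apply: filterS2 => n h1 h2 b.
  by rewrite in_cons => /orP[/eqP ->|/h2].
have : \forall n \near U, (N <= n)%N by apply: oU; exact: nbhs_infty_ge.
move=> h1 h2; have [n [Nn /= hn]] := filter_ex (filterI h1 h2).
exists n => // x; have [a aL xa] := hL x.
have := geq a x (e / 3) xa; have := xa n; have := hn a aL; rewrite !ler_norml.
by move=> /andP[? ?] /andP[? ?] /andP[? ?]; apply/andP; split; lra.
Qed.

Section operator.
Context {R : realType} {G : compactGroupType}.
Variable K : G -> G -> R.
Hypothesis cK : continuous (fun xy => K xy.1 xy.2).
Implicit Types f g : cfun R G.

Lemma op_subproof f : continuous (fun x => mean (fun y => K x y * f y)).
Proof.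
apply: (mean_param_cts (F := fun x y => K x y * f y)).
apply: (cts_mul cK); apply: (@cts_comp _ _ _ (fun xy : G * G => xy.2)).
  by move=> x; exact: cvg_snd.
exact: cfun_cts.
Qed.

Definition op f := mk_cfun (@op_subproof f).

Definition kfun x : cfun R G := mk_cfun (cts_section (x := x) cK).

Lemma opE f x : op f x = ip (kfun x) f. Proof. by []. Qed.

Lemma opD f g : op (f + g) = op f + op g.
Proof. by apply: cfunP => x; rewrite cfunD !opE ipDr. Qed.

Lemma opZ a f : op (a *: f) = a *: op f.
Proof. by apply: cfunP => x; rewrite cfunZ !opE ipZr. Qed.

Lemma op0 : op 0 = 0.
Proof. by have := opZ 0 0; rewrite !scale0r. Qed.

Lemma sqn_kfun_bounded : exists2 C : R, 0 < C & forall x, sqn (kfun x) <= C.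
Proof.
have cm : continuous (fun x => sqn (kfun x)).
  by apply: (mean_param_cts (F := fun x y => K x y * K x y)); exact: cts_mul.
have [C C0 hC] := cts_bounded (@compactG G) cm; exists C => // x.
exact: le_trans (ler_norm _) (hC x).
Qed.

Lemma sqn_kfun_near x (e : R) : 0 < e ->
  \forall x' \near x, sqn (kfun x' - kfun x) <= e ^+ 2.
Proof.
move=> e0; have := @tube R G G K x e (@compactG G) cK e0; apply: filterS => x' h.
by apply: sqn_le => y; exact: ltW (h y).
Qed.

Lemma op_dist f x x' (e : R) : 0 <= e -> sqn f <= 1 -> sqn (kfun x' - kfun x) <= e ^+ 2 ->
  `|op f x' - op f x| <= e.
Proof.
move=> e0 f1 h; rewrite !opE -ipNl -ipDl; apply: norm_le_sqr => //.
apply: (le_trans (cauchy_schwarz _ _)).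
by apply: (le_trans _ h); rewrite ler_piMr ?sqn_ge0.
Qed.

Hypothesis symK : forall x y, K x y = K y x.

Lemma op_sym f g : ip (op f) g = ip f (op g).
Proof.
have c2 (h : cfun R G) : continuous (fun xy : G * G => h xy.2).
  apply: (@cts_comp _ _ _ (fun xy : G * G => xy.2) h); last exact: cfun_cts.
  by move=> x; exact: cvg_snd.
have c1 (h : cfun R G) : continuous (fun xy : G * G => h xy.1).
  apply: (@cts_comp _ _ _ (fun xy : G * G => xy.1) h); last exact: cfun_cts.
  by move=> x; exact: cvg_fst.
rewrite /ip; transitivity (mean (fun x => mean (fun y => g x * (K x y * f y)))).
  congr mean; apply/funext => x.
  rewrite (@meanZ _ _ (g x) (fun y => K x y * f y)) 1?mulrC //.
  by apply: cts_mul; [exact: cts_section|exact: cfun_cts].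
rewrite (@mean_fubini _ _ (fun x y => g x * (K x y * f y))); last first.
  by apply: cts_mul => //; exact: cts_mul.
congr mean; apply/funext => y.
rewrite /= -(@meanZ _ _ (f y) (fun x => K y x * g x)); last first.
  by apply: cts_mul; [exact: cts_section|exact: cfun_cts].
by congr mean; apply/funext => x; rewrite (symK x); ring.
Qed.

(** An invariant subspace closed under uniform limits, in which the eigenvector is sought. It will
    be the orthogonal complement of known eigenfunctions. *)
Variable W : cfun R G -> Prop.
Hypothesis Wlin : forall a f g, W f -> W g -> W (a *: f + g).
Hypothesis Wop : forall f, W f -> W (op f).
Hypothesis Wlim : forall f,
  (forall e : R, 0 < e -> exists2 g, W g & forall x, `|f x - g x| <= e) -> W f.

Let W0 f : W f -> W 0.
Proof. by move=> Wf; rewrite -(subrr f) addrC -scaleN1r; exact: Wlin. Qed.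

Let WZ a f : W f -> W (a *: f).
Proof. by move=> Wf; rewrite -[_ *: _]addr0; apply: Wlin => //; exact: W0 Wf. Qed.

(** [l] is the square of the operator norm of [op] on [W], a supremum that need not be known to be
    attained. *)
Lemma op_bounded f : W f -> op f <> 0 -> exists l : R, [/\ 0 < l,
  (forall h, W h -> sqn (op h) <= l * sqn h) &
  forall e : R, 0 < e -> exists h, [/\ W h, sqn h <= 1 & l - e < sqn (op h)]].
Proof.
move=> Wf opf.
pose Q := [set r | exists h, [/\ W h, sqn h <= 1 & r = sqn (op h)]].
have [C C0 hC] := sqn_kfun_bounded.
have Q0 : Q 0.
  by exists 0; split; [exact: W0 Wf|rewrite /sqn ip0l|rewrite op0 /sqn ip0l].
have sQ : has_sup Q.
  split; first by exists 0.
  exists C => r [h [Wh h1 ->]]; apply: mean_le; first exact: cts_cfun_mul.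
  move=> x; rewrite -expr2 opE; apply: (le_trans (cauchy_schwarz _ _)).
  by apply: (le_trans _ (hC x)); rewrite ler_piMr ?sqn_ge0.
have sqnp h : h <> 0 -> 0 < sqn h.
  by move=> h0; rewrite lt_neqAle sqn_ge0 andbT eq_sym; apply/eqP => /sqn_eq0.
have le_sup h : W h -> sqn h <= 1 -> sqn (op h) <= sup Q.
  by move=> Wh h1; apply: (ub_le_sup sQ.2); exists h.
have f0 : f <> 0 by move=> f0; apply: opf; rewrite f0 op0.
exists (sup Q); split.
(* This factor brings f into the unit ball without a square root. *)
- pose c := (1 + sqn f)^-1; have c0 : 0 < c by rewrite invr_gt0 ltr_pwDl ?sqn_ge0.
  apply: (@lt_le_trans _ _ (sqn (op (c *: f)))).
    by rewrite opZ sqnZ mulr_gt0 ?exprn_gt0 ?sqnp.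
  apply: le_sup; first exact: WZ.
  rewrite sqnZ exprVn ler_pdivrMl ?exprn_gt0 ?ltr_pwDl ?sqn_ge0 // mulr1.
  by have := sqn_ge0 f; nra.
- move=> h Wh; have [->|/eqP h0] := eqVneq h 0; first by rewrite op0 /sqn ip0l mulr0.
  pose c := (Num.sqrt (sqn h))^-1.
  have c2 : c ^+ 2 = (sqn h)^-1 by rewrite exprVn sqr_sqrtr ?sqn_ge0.
  have := le_sup (c *: h) (WZ c Wh); rewrite opZ !sqnZ c2 mulVf ?gt_eqF ?sqnp //.
  by move=> /(_ (lexx _)); rewrite ler_pdivrMl ?sqnp // mulrC.
- by move=> e e0; have [r [h [Wh h1 ->]] hr] := sup_adherent e0 sQ; exists h.
Qed.

(* [op] is self-adjoint and compact, so a sequence maximizing [sqn (op h)] on the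
   unit ball of W accumulates, after applying [op \o op], at an eigenvector. *)
Lemma op_eigen f : W f -> op f <> 0 ->
  exists l g, [/\ 0 < l, W g, g <> 0 & op (op g) = l *: g].
Proof.
move=> Wf opf; have [l [l0 lb ladh]] := op_bounded Wf opf.
have lb2 h : W h -> sqn (op (op h)) <= l ^+ 2 * sqn h.
  move=> Wh; apply: (le_trans (lb _ (Wop Wh))).
  by rewrite expr2 -mulrA ler_pM2l // lb.
have [f_ f_P] := choice (fun n : nat => ladh n.+1%:R^-1 ltac:(rewrite invr_gt0 ltr0n; done)).
pose g_ n := op (op (f_ n)).
have sl : 0 < Num.sqrt l by rewrite sqrtr_gt0.
(* Since [h_ n] lies in the unit ball, writing [g_ n] as a multiple of [op (h_ n)] gives the bound
   and the equicontinuity that [arzela] asks for. *)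
pose h_ n := (Num.sqrt l)^-1 *: op (f_ n).
have sh n : sqn (h_ n) <= 1.
  rewrite sqnZ exprVn sqr_sqrtr ?(ltW l0) // ler_pdivrMl // mulr1.
  have [Wn n1 _] := f_P n; apply: (le_trans (lb _ Wn)).
  by rewrite ler_piMr // ltW.
have g_E n : g_ n = Num.sqrt l *: op (h_ n).
  by rewrite /h_ opZ scalerA mulfV ?scale1r // gt_eqF.
have [C C0 hC] := sqn_kfun_bounded.
have [||g cg hg] := @arzela R G (fun n => g_ n) (Num.sqrt l * Num.sqrt C).
- move=> n x; rewrite g_E cfunZ normrM (ger0_norm (ltW sl)) ler_pM2l //.
  rewrite opE; apply: norm_le_sqr; first exact: sqrtr_ge0.
  rewrite sqr_sqrtr ?(ltW C0) //; apply: (le_trans (cauchy_schwarz _ _)).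
  by apply: (le_trans _ (hC x)); rewrite ler_piMr ?sqn_ge0.
- move=> x e e0; have d0 : 0 < e / Num.sqrt l by rewrite divr_gt0.
  have := sqn_kfun_near x d0; apply: filterS => x' hx' n.
  rewrite g_E !cfunZ -mulrBr normrM (ger0_norm (ltW sl)) mulrC -ler_pdivlMr //.
  by apply: op_dist => //; exact: ltW.
pose g0 := mk_cfun cg.
have Wg_ n : W (g_ n) by have [Wn _ _] := f_P n; do 2 apply: Wop.
have Wg : W g0.
  apply: Wlim => e e0; have [n _ hn] := hg e 0%N e0.
  by exists (g_ n) => // x; rewrite distrC; exact: hn.
have main (e : R) : 0 < e -> exists n, [/\ sqn (g0 - g_ n) <= e ^+ 2,
    sqn (g_ n - l *: f_ n) <= 2 * l * e & l * (l - e) <= sqn (l *: f_ n)].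
  move=> e0; have [N hN] := ltr_add_invr e0; rewrite add0r in hN.
  have [n Nn hn] := hg e N e0; exists n; have [Wn n1 nl] := f_P n.
  have ne : n.+1%:R^-1 < e.
    by apply: le_lt_trans hN; rewrite lef_pV2 ?posrE ?ltr0n // ler_nat ltnS.
  have opn : sqn (op (f_ n)) <= l * sqn (f_ n) by exact: lb.
  have {nl ne} lq : l - sqn (op (f_ n)) <= e by move: (_^-1) nl ne => v; lra.
  split.
  - by apply: sqn_le => x; rewrite distrC; exact: hn.
  (* By self-adjointness the inner product in the cross term is [sqn (op (f_ n))], so the whole is
     at most 2 l (l - [sqn (op (f_ n))]). *)
  - rewrite sqnB sqnZ ipZr /g_ op_sym -[ip (op _) _]/(sqn _).
    have := lb2 _ Wn; have : l ^+ 2 * sqn (f_ n) <= l ^+ 2 by rewrite ler_piMr // sqr_ge0.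
    have : l * (l - sqn (op (f_ n))) <= l * e by rewrite ler_pM2l //; lra.
    by rewrite mulrBr -expr2; lra.
  - by rewrite sqnZ expr2 -mulrA ler_pM2l //; lra.
exists l, g0; split=> //.
(* If the limit were 0, the third bound would give [sqn (l *: f_ n)] at least 90 e^2 and the first
   two at most 42 e^2, for e = l / 10. *)
- move=> g00; have e0 : 0 < l / 10 by lra.
  have [n [h1 h2 h3]] := main _ e0.
  have := sqnD_le (l *: f_ n - g_ n) (g_ n - g0).
  have -> : l *: f_ n - g_ n + (g_ n - g0) = l *: f_ n by rewrite g00 subr0 subrK.
  have -> : sqn (l *: f_ n - g_ n) = sqn (g_ n - l *: f_ n).
    by rewrite -opprB -scaleN1r sqnZ sqrrN expr1n mul1r.
  have -> : sqn (g_ n - g0) = sqn (g0 - g_ n).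
    by rewrite -opprB -scaleN1r sqnZ sqrrN expr1n mul1r.
  by nra.
apply/eqP; rewrite -subr_eq0; apply/eqP; apply: sqn_eq0.
have key (e : R) : 0 < e -> sqn (op (op g0) - l *: g0) <= 8 * (l ^+ 2) * (e ^+ 2 + l * e).
  move=> e0; have [n [h1 h2 _]] := main _ e0; have [Wn _ _] := f_P n.
  pose d := g0 - g_ n; pose r := g_ n - l *: f_ n.
  have Wd : W d by rewrite /d -scaleN1r addrC; exact: Wlin.
  have Wr : W r by rewrite /r -scaleNr addrC; exact: Wlin.
  (* As [g_ n] is [op (op (f_ n))], the two terms l [g_ n] cancel. *)
  have -> : op (op g0) - l *: g0 = op (op d) + op (op r) - l *: d.
    have opB f1 f2 : op (f1 - f2) = op f1 - op f2.
      by rewrite opD -scaleN1r opZ scaleN1r.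
    rewrite /d /r !opB !opZ scalerBr -/(g_ n).
    by apply: cfunP => x; rewrite !(cfunB, cfunD); ring.
  apply: (le_trans (sqnD_le _ _)).
  rewrite -scaleNr sqnZ sqrrN.
  have := sqnD_le (op (op d)) (op (op r)); have := lb2 _ Wd; have := lb2 _ Wr.
  rewrite -/d in h1; rewrite -/r in h2; have : 0 <= l ^+ 2 by rewrite sqr_ge0.
  nra.
apply: eq_eps => e e0; rewrite subr0 ger0_norm ?sqn_ge0 //.
pose D := 8 * l ^+ 2 * (1 + l); have D0 : 0 < D by rewrite !mulr_gt0 ?exprn_gt0 // addr_gt0.
(* The cap at 1 gives d^2 <= d, which turns the bound of [key] into one linear in d. *)
pose d := Num.min 1 (e / D); have d0 : 0 < d by rewrite lt_min ltr01 divr_gt0.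
have d1 : d <= 1 by rewrite ge_min lexx.
have dD : D * d <= e by rewrite mulrC -ler_pdivlMr // ge_min lexx orbT.
apply: (le_trans (key d d0)); apply: le_trans dD.
have -> : D * d = 8 * l ^+ 2 * (d + l * d) by rewrite /D; ring.
rewrite ler_pM2l ?mulr_gt0 ?exprn_gt0 // lerD2r.
by rewrite expr2 ler_piMl // ltW.
Qed.

End operator.

(** * The Peter-Weyl theorem *)

Section translation.
Context {R : realType} {G : compactGroupType}.
Implicit Types (f h : cfun R G) (g : G).

Lemma tr_subproof g f : continuous (fun x => f (g^-1 * x)%g).
Proof. by apply: (@cts_comp _ _ _ _ f); [exact: cts_mull|exact: cfun_cts]. Qed.

Definition tr g f := mk_cfun (@tr_subproof g f).

Lemma trE g f x : tr g f x = f (g^-1 * x)%g. Proof. by []. Qed.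

Lemma trZ g a f : tr g (a *: f) = a *: tr g f.
Proof. by apply: cfunP. Qed.

Lemma tr_sum g (I : Type) (s : seq I) (F : I -> cfun R G) :
  tr g (\sum_(i <- s) F i) = \sum_(i <- s) tr g (F i).
Proof.
by apply: cfunP => x; rewrite trE !cfun_sum; apply: eq_bigr => i _.
Qed.

Lemma tr1 f : tr 1%g f = f.
Proof. by apply: cfunP => x; rewrite trE invg1 mul1g. Qed.

Lemma trM g g' f : tr (g * g')%g f = tr g (tr g' f).
Proof. by apply: cfunP => x; rewrite !trE invgM mulgA. Qed.

Lemma ip_tr g f h : ip (tr g f) (tr g h) = ip f h.
Proof.
exact: (@mean_mull _ _ (g^-1)%g (fun x => f x * h x) (cts_cfun_mul (f := f) (g := h))).
Qed.

Lemma ip_trl g f h : ip (tr g f) h = ip f (tr g^-1%g h).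
Proof. by rewrite -(ip_tr g^-1%g) -trM mulVg tr1. Qed.

End translation.

Section peter_weyl.
Context {R : realType} {G : compactGroupType}.
Variable F : G -> R.
Hypothesis cF : continuous F.
Implicit Types (f h : cfun R G) (g : G).

(** Unlike convolution by F itself, convolution by this function has a symmetric kernel. That kernel
    is invariant under left translation, so the operator commutes with [tr]. *)
Definition autocorrelation x : R := mean (fun y => F (x * y)%g * F y).
Definition akernel x y := autocorrelation (x^-1 * y)%g.

Lemma autocorrelation_cts : continuous autocorrelation.
Proof.
apply: (mean_param_cts (F := fun x y => F (x * y)%g * F y)); apply: cts_mul.
  by apply: (cts_comp _ cF); exact: mulg_continuous.
by apply: (@cts_comp _ _ _ (fun xy : G * G => xy.2)) cF => x; exact: cvg_snd.
Qed.

Lemma akernel_cts : continuous (fun xy => akernel xy.1 xy.2).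
Proof.
apply: (@cts_comp _ _ _ (fun xy : G * G => (xy.1^-1 * xy.2)%g)) autocorrelation_cts.
apply: cts_mulg; last by move=> x; exact: cvg_snd.
by apply: cts_invg => x; exact: cvg_fst.
Qed.

Lemma akernel_sym x y : akernel x y = akernel y x.
Proof.
have cfx (z : G) : continuous (fun y => F (z * y)%g * F y).
  by apply: (cts_mul _ cF); apply: (cts_comp _ cF); exact: cts_mull.
rewrite /akernel /autocorrelation -(mean_mull (y^-1 * x)%g (cfx _)).
congr mean; apply/funext => z; rewrite mulrC; congr (_ * F _).
by rewrite !mulgA -(mulgA _ y) mulgV mulg1 mulVg mul1g.
Qed.

Local Notation S := (op akernel_cts).

Lemma op_tr g f : S (tr g f) = tr g (S f).
Proof.
apply: cfunP => x; rewrite trE !opE /ip.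
rewrite -(@mean_mull _ _ g (fun y => _)); last exact: cts_cfun_mul.
by congr mean; apply/funext => y /=; rewrite mulKg /akernel invgM invgK mulgA.
Qed.

(** Eigenfunctions for a nonzero eigenvalue lie in the image of [S], so this makes their
    representation trivial on every g that F does not see. *)
Lemma tr_op_trivial g f : (forall x y, F (x * g * y)%g = F (x * y)%g) ->
  tr g (S f) = S f.
Proof.
move=> Fg; apply: cfunP => x; rewrite trE !opE; congr mean; apply/funext => y /=.
rewrite /akernel /autocorrelation; congr (_ * _); congr mean; apply/funext => z.
by have := Fg x^-1%g (y * z)%g; rewrite invgM invgK !mulgA => ->.
Qed.

(* If a fixed all eigenfunctions, every [f - tr a f] would be orthogonal to them,
   hence killed by [S]; so the autocorrelation would agree at 1 and a, and the
   equality case of Cauchy-Schwarz would give F (a y) = F y. *)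
Lemma akernel_separates a : F a <> F 1%g ->
  exists l f, [/\ 0 < l, S (S f) = l *: f & tr a f <> f].
Proof.
move=> Fa; apply/not_existsP => noeig; apply: Fa.
have {}noeig l f : 0 < l -> S (S f) = l *: f -> tr a f = f.
  move=> l0 Sf; apply: contrapT => trf; apply: (noeig l).
  by exists f.
(* [W] is the orthogonal complement of all eigenfunctions. By [op_eigen], [S] must vanish on it,
   since an eigenfunction inside [W] would be orthogonal to itself. *)
pose W f := forall l h, 0 < l -> S (S h) = l *: h -> ip f h = 0.
have Wlin c f h : W f -> W h -> W (c *: f + h).
  by move=> Wf Wh l u l0 Su; rewrite ipDl ipZl (Wf l) ?(Wh l) // mulr0 addr0.
have Wop f : W f -> W (S f).
  move=> Wf l u l0 Su; rewrite (op_sym akernel_cts akernel_sym).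
  by apply: (Wf l) => //; rewrite Su opZ.
have Wlim f : (forall e : R, 0 < e -> exists2 h, W h & forall x, `|f x - h x| <= e) -> W f.
  move=> fl l u l0 Su; apply: eq_eps => e e0; rewrite subr0.
  pose d := e / Num.sqrt (1 + sqn u).
  have u0 : 0 < 1 + sqn u by have := sqn_ge0 u; lra.
  have s0 : 0 < Num.sqrt (1 + sqn u) by rewrite sqrtr_gt0.
  have d0 : 0 < d by rewrite divr_gt0.
  have [h Wh hd] := fl d d0; have -> : ip f u = ip (f - h) u.
    by rewrite ipDl ipNl (Wh l) // subr0.
  apply: norm_le_sqr; first exact: ltW.
  apply: (le_trans (cauchy_schwarz _ _)).
  apply: (@le_trans _ _ (d ^+ 2 * (1 + sqn u))).
    apply: ler_pM; rewrite ?sqn_ge0 //; last by rewrite lerDr.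
    by apply: sqn_le => x; exact: hd.
  by rewrite -[X in _ * X](sqr_sqrtr (ltW u0)) -exprMn divfK // gt_eqF.
have S0 f : W f -> S f = 0.
  move=> Wf; apply: contrapT => Sf.
  have [l [u [l0 Wu u0 Su]]] := op_eigen akernel_sym Wlin Wop Wlim Wf Sf.
  by apply: u0; apply: sqn_eq0; exact: (Wu l).
have S1 f : S (f - tr a f) = 0.
  apply: S0 => l u l0 Su; rewrite ipDl ipNl -[in X in _ - X](noeig l u l0 Su).
  by rewrite ip_tr subrr.
pose K1 := kfun akernel_cts 1%g.
have ipK1 f : ip K1 f = ip (tr a^-1%g K1) f.
  apply/eqP; rewrite ip_trl invgK -subr_eq0 -ipNr -ipDr; apply/eqP.
  by rewrite -[LHS]opE S1.
have /sqn_eq0 K1a : sqn (K1 - tr a^-1%g K1) = 0.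
  by rewrite /sqn {1}ipDl ipNl -ipK1 subrr.
have ka : autocorrelation 1%g = autocorrelation a.
  have := congr1 (fun f : cfun R G => f 1%g) K1a.
  rewrite cfunB cfun0 trE /= /akernel invgK invg1 !mul1g mulg1.
  by move/eqP; rewrite subr_eq0 => /eqP.
have cFa : continuous (fun y => F (a * y)%g) by apply: (cts_comp _ cF); exact: cts_mull.
have cFd : continuous (fun y => F (a * y)%g - F y) by exact: cts_sub.
have m0 : mean (fun y => (F (a * y)%g - F y) * (F (a * y)%g - F y)) = 0.
  transitivity (mean (fun y => F (a * y)%g * F (a * y)%g + F y * F y - 2 * (F (a * y)%g * F y))).
    by congr mean; apply/funext => y; ring.
  have c2 := cts_mul cF cF; have c1 := cts_mul cFa cFa; have c3 := cts_mul cFa cF.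
  rewrite meanB; [|exact: cts_add|by apply: cts_mul => //; exact: cts_cst].
  rewrite meanD // meanZ // (mean_mull a c2).
  rewrite /autocorrelation in ka; rewrite -ka.
  have -> : mean (fun y => F (1 * y)%g * F y) = mean (fun y => F y * F y).
    by congr mean; apply/funext => y; rewrite mul1g.
  by ring.
have := mean_eq0 (cts_mul cFd cFd) _ m0 1%g; rewrite mulg1 => h.
apply/eqP; rewrite -subr_eq0 -sqrf_eq0 expr2; apply/eqP; apply: h => y.
by rewrite -expr2 sqr_ge0.
Qed.

(* Integrate Bessel's inequality for the functions [S (kfun x)] over x. *)
Lemma eigenspace_bounded (l : R) : 0 < l -> exists M : nat,
  forall m (b : 'I_m -> cfun R G), orthonormal b ->
    (forall i, S (S (b i)) = l *: b i) -> (m <= M)%N.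
Proof.
move=> l0; have [C C0 hC] := sqn_kfun_bounded akernel_cts.
(* [l * b i x] is the coefficient of [S (kfun x)] along [b i], and [S (kfun x)] is bounded by [C];
   taking means gives m l^2 <= C^2. *)
exists (Num.bound (C ^+ 2 / l ^+ 2)) => m b ob eb.
rewrite -(ler_nat R) ltW //; apply: le_lt_trans (archi_boundP _); last first.
  by rewrite divr_ge0 ?exprn_ge0 // ltW.
rewrite ler_pdivlMr ?exprn_gt0 //.
have -> : m%:R * l ^+ 2 = mean (fun x => \sum_i (l * b i x) * (l * b i x)).
  rewrite mean_sum => [|i]; last by exact: (cts_cfun_mul (f := l *: b i) (g := l *: b i)).
  rewrite (eq_bigr (fun=> l ^+ 2)) ?sumr_const ?card_ord ?mulr_natl // => i _.
  by rewrite -[LHS]/(sqn (l *: b i)) sqnZ /sqn ob eqxx mulr1.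
apply: mean_le.
  by apply: cts_sum => i; exact: (cts_cfun_mul (f := l *: b i) (g := l *: b i)).
move=> x; have bix i : l * b i x = ip (b i) (S (kfun akernel_cts x)).
  by rewrite -cfunZ -eb opE -(op_sym akernel_cts akernel_sym) ipC.
under eq_bigr do rewrite bix -expr2.
apply: (le_trans (bessel _ ob)); apply: sqn_le => y.
rewrite opE; apply: norm_le_sqr; first exact: ltW.
by apply: (le_trans (cauchy_schwarz _ _)); rewrite expr2 ler_pM ?sqn_ge0.
Qed.

(** Translations commute with [S] and preserve the inner product, so they act orthogonally on the
    finite-dimensional eigenspace containing a function that [a] moves. *)
Lemma peter_weyl_separation a : F a <> F 1%g ->
  exists d (rho : G -> 'M[R]_d), [/\ {morph rho : g h / (g * h)%g >-> g *m h},
    forall g, rho g *m (rho g)^T = 1%:M,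
    forall i j, continuous (fun g => rho g i j),
    forall g, (forall x y, F (x * g * y)%g = F (x * y)%g) -> rho g = 1%:M
  & rho a <> 1%:M].
Proof.
move=> Fa; have [l [f [l0 Sf traf]]] := akernel_separates Fa.
have [M hM] := eigenspace_bounded l0.
have Elin c u v : S (S u) = l *: u -> S (S v) = l *: v ->
    S (S (c *: u + v)) = l *: (c *: u + v).
  by move=> Su Sv; rewrite !opD !opZ Su Sv scalerDr !scalerA mulrC.
have [d [b [ob Eb bP]]] := orthonormal_basis Elin hM.
pose rho g := \matrix_(i, j) ip (b i) (tr g (b j)).
have Etr g u : S (S u) = l *: u -> S (S (tr g u)) = l *: tr g u.
  by move=> Su; rewrite !op_tr Su trZ.
have trb g j : tr g (b j) = \sum_i rho g i j *: b i.
  rewrite [LHS]bP; last exact: Etr.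
  by apply: eq_bigr => i _; rewrite mxE.
have rhoM : {morph rho : g h / (g * h)%g >-> g *m h}.
  move=> g h; apply/matrixP => i j; rewrite !mxE trM trb tr_sum ip_sumr.
  by apply: eq_bigr => k _; rewrite trZ ipZr mulrC !mxE.
have rho_id g : (forall j, tr g (b j) = b j) -> rho g = 1%:M.
  by move=> h; apply/matrixP => i j; rewrite !mxE h ob.
exists d, rho; split=> //.
- move=> g; have -> : (rho g)^T = rho g^-1%g.
    by apply/matrixP => i j; rewrite !mxE ipC ip_trl.
  by rewrite -rhoM mulgV; apply: rho_id => j; exact: tr1.
- move=> i j; have -> : (fun g => rho g i j) = (fun g => mean (fun x => b i x * b j (g^-1 * x)%g)).
    by apply/funext => g; rewrite mxE.
  apply: (mean_param_cts (F := fun g x => b i x * b j (g^-1 * x)%g)); apply: cts_mul.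
    apply: (@cts_comp _ _ _ (fun xy : G * G => xy.2)); last exact: cfun_cts.
    by move=> x; exact: cvg_snd.
  apply: (@cts_comp _ _ _ (fun xy : G * G => (xy.1^-1 * xy.2)%g)); last exact: cfun_cts.
  apply: cts_mulg; last by move=> x; exact: cvg_snd.
  by apply: cts_invg => x; exact: cvg_fst.
- move=> g Fg; apply: rho_id => j.
  have -> : b j = l^-1 *: S (S (b j)) by rewrite Eb scalerA mulVf ?scale1r // gt_eqF.
  by rewrite trZ tr_op_trivial.
- move=> rhoa; apply: traf; rewrite (bP f Sf) tr_sum; apply: eq_bigr => j _.
  rewrite trZ trb rhoa (bigD1 j) //= mxE eqxx scale1r big1 ?addr0 // => i ij.
  by rewrite mxE (negbTE ij) scale0r.
Qed.

End peter_weyl.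

(** * Functions and representations trivial on a normal subgroup *)

Section separating_function.
Context {R : realType} {H G : compactGroupType} (iota : H -> G).
Hypothesis iota_hom : continuous_hom iota.
Hypothesis iota_normal : normal_subgroup (range iota).

(** An Urysohn function for the disjoint closed cosets N and aN is averaged over H on the right. On
    these two cosets it is constant, so averaging leaves the values 0 and 1. *)
Lemma separating_function a : ~ range iota a -> exists F : G -> R,
  [/\ continuous F, F a <> F 1%g & forall h x y, F (x * iota h * y)%g = F (x * y)%g].
Proof.
move=> Na; have [iotaM iotac] := iota_hom.
pose N := range iota; pose aN := [set (a * x)%g | x in N].
have cN : compact N.
  by apply: continuous_compact; [exact: continuous_subspaceT|exact: compactG].
have caN : compact aN.
  apply: continuous_compact => //; apply: continuous_subspaceT; exact: cts_mull.
have NaN : N `&` aN = set0.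
  rewrite -subset0 => x [Nx [y Ny axy]]; apply: Na; have [_ NM NV _] := iota_normal.
  by rewrite -(mulgK y a) axy; apply: NM => //; exact: NV.
have nG := compact_normal (@hausdorffG G) (@compactG G).
have clN := compact_closed (@hausdorffG G) cN.
have claN := compact_closed (@hausdorffG G) caN.
have /(uniform_separatorP (R := R)) [f [cf _ f0 f1]] :=
  (normal_separatorP (R := R)).1 nG N aN clN claN NaN.
have N1 : N 1%g by case: iota_normal.
have cfi : continuous (fun xh : G * H => f (xh.1 * iota xh.2)%g).
  apply: (@cts_comp _ _ _ (fun xh : G * H => (xh.1 * iota xh.2)%g)) cf.
  apply: cts_mulg; first by move=> x; exact: cvg_fst.
  by apply: cts_comp iotac => x; exact: cvg_snd.
pose F x := mean (fun h => f (x * iota h)%g).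
have FN h x : F (x * iota h)%g = F x.
  rewrite /F -(@mean_mull _ _ h (fun h => f (x * iota h)%g)); last first.
    exact: (cts_section (F := fun x h => f (x * iota h)%g)).
  by congr mean; apply/funext => h'; rewrite iotaM mulgA.
exists F; split.
- exact: (mean_param_cts (F := fun x h => f (x * iota h)%g)).
- have -> : F a = 1.
    rewrite /F -[RHS](@mean_cst R H 1); congr mean; apply/funext => h.
    by apply: f1; exists (a * iota h)%g => //; exists (iota h) => //; exists h.
  have -> : F 1%g = 0.
    rewrite /F -[RHS](@mean_cst R H 0); congr mean; apply/funext => h.
    by apply: f0; exists (1 * iota h)%g => //; rewrite mul1g; exists h.
  by apply/eqP; exact: oner_neq0.
(* Normality moves [iota h] past y, where right invariance absorbs its conjugate. *)
- move=> h x y; have [_ _ _ /(_ (iota h) y)] := iota_normal.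
  have Nh : N (iota h) by exists h.
  move=> /(_ Nh) [h' _ h'E]; rewrite -(FN h' (x * y)%g) h'E /conjg.
  by rewrite !mulgA mulgK.
Qed.

End separating_function.

Section doubling.
Context {R : realType} {d : nat}.
Implicit Types A B : 'M[R]_d.

(* The matrix of [A (+) 1] in the basis ((e_i, e_i), (e_i, -e_i)) / sqrt 2. *)
Definition dbl A : 'M[R]_(d + d) :=
  block_mx (2^-1 *: (A + 1%:M)) (2^-1 *: (A - 1%:M))
           (2^-1 *: (A - 1%:M)) (2^-1 *: (A + 1%:M)).

Lemma dblM A B : dbl A *m dbl B = dbl (A *m B).
Proof.
rewrite /dbl mulmx_block -!scalemxAl -!scalemxAr.
rewrite !mulmxDl !mulmxDr !mulmxN !mulNmx !mul1mx !mulmx1.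
by congr block_mx; move: (A *m B) => C; apply/matrixP => i j; rewrite !mxE; field.
Qed.

Lemma dbl1 : dbl 1%:M = 1%:M.
Proof.
have h : 2^-1 *: (1%:M + 1%:M) = 1%:M :> 'M[R]_d.
  by apply/matrixP => i j; rewrite !mxE; field.
by rewrite /dbl subrr scaler0 scalar_mx_block h.
Qed.

Lemma dbl_tr A : (dbl A)^T = dbl A^T.
Proof. by rewrite /dbl tr_block_mx !linearZ /= !linearD /= !linearN /= trmx1. Qed.

(** The off-diagonal blocks are (A - 1) / 2, so even a diagonal A leaves a nonzero entry there, and
    its two indices differ because they lie in different blocks. *)
Lemma dbl_offdiag A : A <> 1%:M -> exists s t, s != t /\ dbl A s t != 0.
Proof.
move=> A1; have [i [j Aij]] : exists i j, A i j != (1%:M : 'M[R]_d) i j.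
  apply: contrapT => h; apply: A1; apply/matrixP => i j; apply/eqP.
  by apply: contrapT => /negP Aij; apply: h; exists i, j.
exists (rshift d i), (lshift d j); split; first by rewrite eq_sym eq_lrshift.
by rewrite block_mxEdl !mxE mulf_neq0 ?invr_eq0 ?pnatr_eq0 // subr_eq0; move: Aij; rewrite !mxE.
Qed.

End doubling.

Lemma normal_quotient_rep {R : realType} {H G : compactGroupType} (iota : H -> G) a :
  continuous_hom iota -> normal_subgroup (range iota) -> ~ range iota a ->
  exists d (rho : G -> 'M[R]_d), [/\ {morph rho : g h / (g * h)%g >-> g *m h},
    forall g, rho g *m (rho g)^T = 1%:M,
    forall i j, continuous (fun g => rho g i j),
    forall h, rho (iota h) = 1%:M
  & exists s t, s != t /\ rho a s t != 0].
Proof.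
move=> iota_hom iota_normal /(separating_function (R := R) iota_hom iota_normal).
move=> [F [cF Fa Fi]].
have [d [rho [rhoM rhoT rhoc rho1 rhoa]]] := peter_weyl_separation cF Fa.
exists (d + d)%N, (fun g => dbl (rho g)); split.
- by move=> g h; rewrite rhoM dblM.
- by move=> g; rewrite dbl_tr dblM rhoT dbl1.
- have cA (i j : 'I_d) (c : R) : continuous (fun g => 2^-1 * (rho g i j + c)).
    by apply: cts_mul; [exact: cts_cst|apply: cts_add => //; exact: cts_cst].
  move=> i j; rewrite -(fintype.splitK i) -(fintype.splitK j).
  case: (fintype.split i) => {}i; case: (fintype.split j) => {}j /=.
  + have -> : (fun g => dbl (rho g) (lshift d i) (lshift d j)) =
       (fun g => 2^-1 * (rho g i j + (i == j)%:R)).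
      by apply/funext => g; rewrite block_mxEul !mxE.
    exact: cA.
  + have -> : (fun g => dbl (rho g) (lshift d i) (rshift d j)) =
       (fun g => 2^-1 * (rho g i j - (i == j)%:R)).
      by apply/funext => g; rewrite block_mxEur !mxE.
    exact: cA.
  + have -> : (fun g => dbl (rho g) (rshift d i) (lshift d j)) =
       (fun g => 2^-1 * (rho g i j - (i == j)%:R)).
      by apply/funext => g; rewrite block_mxEdl !mxE.
    exact: cA.
  + have -> : (fun g => dbl (rho g) (rshift d i) (rshift d j)) =
       (fun g => 2^-1 * (rho g i j + (i == j)%:R)).
      by apply/funext => g; rewrite block_mxEdr !mxE.
    exact: cA.
- by move=> h; rewrite rho1 ?dbl1.
- exact: dbl_offdiag.
Qed.

(** * Orthogonal groups *)

Section orthogonal_group.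
Context {R : realType} {N : nat}.

Record ortho := Ortho {
  ortho_mx :> 'M[R]_N ; ortho_prop : ortho_mx *m ortho_mx^T == 1%:M }.

HB.instance Definition _ := [isSub for ortho_mx].
HB.instance Definition _ := [Choice of ortho by <:].

Implicit Types A B : ortho.

Lemma orthoP A : A *m A^T = 1%:M.
Proof. exact/eqP/ortho_prop. Qed.

Lemma orthoPl A : A^T *m A = 1%:M.
Proof. exact/mulmx1C/orthoP. Qed.

Lemma ortho_mul_subproof A B : (A *m B) *m (A *m B)^T == 1%:M.
Proof. by rewrite trmx_mul mulmxA -(mulmxA A) orthoP mulmx1 orthoP. Qed.

Lemma ortho_inv_subproof A : A^T *m A^T^T == 1%:M.
Proof. by rewrite trmxK orthoPl. Qed.

Lemma ortho_one_subproof : (1%:M : 'M[R]_N) *m 1%:M^T == 1%:M.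
Proof. by rewrite trmx1 mulmx1. Qed.

Definition ortho_mul A B := Ortho (ortho_mul_subproof A B).
Definition ortho_inv A := Ortho (ortho_inv_subproof A).
Definition ortho_one := Ortho ortho_one_subproof.

Lemma ortho_mulA : associative ortho_mul.
Proof. by move=> A B C; apply: val_inj; rewrite /= mulmxA. Qed.
Lemma ortho_mul1 : left_id ortho_one ortho_mul.
Proof. by move=> A; apply: val_inj; rewrite /= mul1mx. Qed.
Lemma ortho_1mul : right_id ortho_one ortho_mul.
Proof. by move=> A; apply: val_inj; rewrite /= mulmx1. Qed.
Lemma ortho_mulV : left_inverse ortho_one ortho_inv ortho_mul.
Proof. by move=> A; apply: val_inj; rewrite /= orthoPl. Qed.
Lemma ortho_Vmul : right_inverse ortho_one ortho_inv ortho_mul.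
Proof. by move=> A; apply: val_inj; rewrite /= orthoP. Qed.

HB.instance Definition _ := isGroup.Build ortho
  ortho_mulA ortho_mul1 ortho_1mul ortho_mulV ortho_Vmul.

HB.instance Definition _ := Topological.copy ortho (initial_topology ortho_mx).

Lemma cts_ortho_entry i j : continuous (fun A : ortho => A i j).
Proof.
apply: (@cts_comp _ _ _ ortho_mx (fun M : 'M[R]_N => M i j)).
  exact: initial_continuous.
exact: coord_continuous.
Qed.

Lemma cvg_ortho (T : Type) (F : set_system T) (f : T -> ortho) (A : ortho) :
  Filter F -> (forall i j, (fun x => f x i j) @ F --> A i j) -> f @ F --> A.
Proof.
move=> FF fA B; rewrite nbhsE => -[_ [[C oC <-] CA] CB].
have : nbhs (ortho_mx A) C by exact: open_nbhs_nbhs.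
move=> [P nP PC]; apply: (@filterS _ _ _ [set x | forall ij, P ij.1 ij.2 (f x ij.1 ij.2)]).
  by move=> x Px; apply: CB; apply: PC => i j; exact: (Px (i, j)).
apply: (@filter_forall _ _ (fun (ij : 'I_N * 'I_N) x => P ij.1 ij.2 (f x ij.1 ij.2))).
by move=> [i j]; apply: fA; exact: nP.
Qed.

Lemma cts_ortho (X : topologicalType) (f : X -> ortho) :
  (forall i j, continuous (fun x => f x i j)) -> continuous f.
Proof. by move=> cf x; apply: cvg_ortho => i j; exact: cf. Qed.

Lemma ortho_mulg_continuous : continuous (fun AB : ortho * ortho => (AB.1 * AB.2)%g).
Proof.
apply: cts_ortho => i j.
have -> : (fun AB : ortho * ortho => (AB.1 * AB.2)%g i j) =
          (fun AB => \sum_k AB.1 i k * AB.2 k j).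
  by apply/funext => AB; rewrite mxE.
apply: cts_sum => k; apply: cts_mul.
  by apply: cts_comp (@cts_ortho_entry i k) => x; exact: cvg_fst.
by apply: cts_comp (@cts_ortho_entry k j) => x; exact: cvg_snd.
Qed.

Lemma ortho_invg_continuous : continuous (fun A : ortho => A^-1%g).
Proof.
apply: cts_ortho => i j.
have -> : (fun A : ortho => A^-1%g i j) = (fun A => A j i).
  by apply/funext => A; rewrite mxE.
exact: cts_ortho_entry.
Qed.

HB.instance Definition _ := Group_isTopologicalGroup.Build ortho
  ortho_mulg_continuous ortho_invg_continuous.

Lemma ortho_entry_le1 A i j : `|A i j| <= 1.
Proof.
apply: norm_le_sqr => //; rewrite expr1n.
have : (A *m A^T) i i = 1 by rewrite orthoP mxE eqxx.
rewrite mxE (bigD1 j) //= mxE -expr2 => <-; rewrite lerDl sumr_ge0 // => k _.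
by rewrite mxE -expr2 sqr_ge0.
Qed.

Lemma ortho_compact : compact [set: ortho].
Proof.
rewrite compact_ultra => F FU _; have FP : ProperFilter F by exact: ultra_proper.
have lim (ij : 'I_N * 'I_N) : exists l : R, (fun A : ortho => A ij.1 ij.2) @ F --> l.
  apply: (@ultra_lim _ R F `[(- 1), 1] (fun A : ortho => A ij.1 ij.2)) => //.
    exact: segment_compact.
  by move=> A; rewrite /= in_itv /= -ler_norml ortho_entry_le1.
have {lim} [L LP] := choice lim.
pose M := \matrix_(i, j) L (i, j).
have MM : M *m M^T == 1%:M.
  apply/eqP/matrixP => i j; rewrite mxE.
  have c1 : (fun A : ortho => \sum_k A i k * A j k) @ F --> \sum_k M i k * M^T k j.
    apply: cvg_sumr => k; rewrite !mxE.
    by apply: cvgM; [exact: (LP (i, k))|exact: (LP (j, k))].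
  have c2 : (fun A : ortho => \sum_k A i k * A j k) @ F --> (1%:M : 'M[R]_N) i j.
    have -> : (fun A : ortho => \sum_k A i k * A j k) = (fun=> (1%:M : 'M[R]_N) i j).
      apply/funext => A; rewrite -(orthoP A) mxE; apply: eq_bigr => k _.
      by rewrite mxE.
    exact: cvg_cst.
  exact: (cvg_unique (@norm_hausdorff _ _) c1 c2).
exists (Ortho MM); split=> //=.
apply: (@cvg_ortho _ F id) => i j; rewrite mxE; exact: (LP (i, j)).
Qed.

Lemma ortho_hausdorff : hausdorff_space ortho.
Proof.
move=> A B AB; apply: val_inj; apply/matrixP => i j.
apply: (@cluster_continuous _ R (fun A : ortho => A i j) _ _ _ (@cts_ortho_entry i j) AB).
exact: norm_hausdorff.
Qed.

HB.instance Definition _ := TopologicalGroup_isCompactGroup.Build ortho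
  ortho_compact ortho_hausdorff.

End orthogonal_group.
Arguments ortho : clear implicits.

(** * Representations separating reduced words *)

Section words.
Context {R : realType} {H : compactGroupType} {I : Type} {G : I -> compactGroupType}.
Variable iota : forall i, H -> G i.

Definition letter := {i : I & G i}.

Fixpoint reduced (w : seq letter) : Prop :=
  if w is b :: w' then
    [/\ reduced w', ~ range (iota (tag b)) (tagged b)
      & if w' is b' :: _ then tag b' <> tag b else True]
  else True.

(** The last clause makes every such family a cocone with constant leg 1 at H, which imposes no
    relation between different [phi i]. *)
Definition rep_family N (phi : forall i, G i -> 'M[R]_N) : Prop :=
  [/\ forall i, {morph phi i : g h / (g * h)%g >-> g *m h},
      forall i g, phi i g *m (phi i g)^T = 1%:M,
      forall i k l, continuous (fun g => phi i g k l)
    & forall i h, phi i (iota i h) = 1%:M].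

Lemma rep_family1 N (phi : forall i, G i -> 'M[R]_N) i :
  rep_family phi -> phi i 1%g = 1%:M.
Proof.
move=> [phiM phiT _ _]; have := phiM i 1%g 1%g; rewrite mulg1 => h.
by rewrite -[LHS]mulmx1 -(phiT i 1%g) mulmxA -h phiT.
Qed.

Lemma rep_family_tr N (phi : forall i, G i -> 'M[R]_N) i g :
  rep_family phi -> (phi i g)^T = phi i g^-1%g.
Proof.
move=> rphi; have [phiM phiT _ _] := rphi.
by rewrite -[LHS]mul1mx -(rep_family1 i rphi) -(mulVg g) phiM -mulmxA phiT mulmx1.
Qed.

Hypothesis iota_hom : forall i, continuous_hom (iota i).
Hypothesis iota_normal : forall i, normal_subgroup (range (iota i)).

Lemma letter_rep i0 (a : G i0) : ~ range (iota i0) a ->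
  exists d (psi : forall i, G i -> 'M[R]_d) s t, [/\ rep_family psi,
    forall i g, i <> i0 -> psi i g = 1%:M, s != t & psi i0 a s t != 0].
Proof.
move=> /(normal_quotient_rep (R := R) (iota_hom i0) (iota_normal i0)).
move=> [d [rho [rhoM rhoT rhoc rho1 [s [t [st rhoa]]]]]].
pose psi i (g : G i) : 'M[R]_d :=
  if pselect (i = i0) is left e then rho (ecast j (G j) e g) else 1%:M.
have psi0 g : psi i0 g = rho g.
  by rewrite /psi; case: pselect => // e; rewrite (Prop_irrelevance e erefl).
have psiN i g : i <> i0 -> psi i g = 1%:M by rewrite /psi; case: pselect.
exists d, psi, s, t; split=> //; last by rewrite psi0.
split=> i; have [e|ne] := pselect (i = i0); try (subst i).
- by move=> g h; rewrite !psi0 rhoM.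
- by move=> g h; rewrite !psiN // mulmx1.
- by move=> g; rewrite psi0 rhoT.
- by move=> g; rewrite psiN // trmx1 mulmx1.
- have -> : psi i0 = rho by apply/funext.
  exact: rhoc.
- have -> : psi i = (fun=> 1%:M) by apply/funext => g; exact: psiN.
  by move=> k l; exact: cts_cst.
- by move=> h; rewrite psi0 rho1.
- by move=> h; rewrite psiN.
Qed.

(** * Gluing two representations along a vector *)

Section glue.
Variables (N d : nat) (y : 'I_N) (t : 'I_d).

(** Vector t of the second space is identified with vector y of the first. The index [rshift N t]
    remains as a spare fixed vector, which keeps the dimension a plain sum. *)
Definition glue_index (z : 'I_d) : 'I_(N + d) :=
  if z == t then lshift d y else rshift N z.

Definition glue_mx : 'M[R]_(N + d, d) := \matrix_(k, z) (k == glue_index z)%:R.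

Lemma glue_index_inj : injective glue_index.
Proof.
move=> z z'; rewrite /glue_index; case: eqP => [->|_]; case: eqP => [->|_] //.
- by move/eqP; rewrite eq_lrshift.
- by move/eqP; rewrite eq_rlshift.
- exact: rshift_inj.
Qed.

Lemma glue_mxE k z : glue_mx k z = (k == glue_index z)%:R.
Proof. by rewrite mxE. Qed.

Lemma mul_glue_mx m (M : 'M[R]_(m, N + d)) k z : (M *m glue_mx) k z = M k (glue_index z).
Proof.
rewrite mxE (bigD1 (glue_index z)) //= mxE eqxx mulr1 big1 ?addr0 // => l lz.
by rewrite mxE (negbTE lz) mulr0.
Qed.

Lemma glue_mx_mul m (M : 'M[R]_(N + d, m)) z k : (glue_mx^T *m M) z k = M (glue_index z) k.
Proof. by rewrite -[M in LHS]trmxK -trmx_mul mxE mul_glue_mx mxE. Qed.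

Lemma glue_mxK : glue_mx^T *m glue_mx = 1%:M.
Proof.
by apply/matrixP => z z'; rewrite mul_glue_mx !mxE eq_sym (inj_eq glue_index_inj) eq_sym.
Qed.

(** [glue_mx] is an isometry; this is A on its image and the identity on the orthogonal
    complement. *)
Definition extend (A : 'M[R]_d) : 'M[R]_(N + d) :=
  1%:M + glue_mx *m (A - 1%:M) *m glue_mx^T.

Lemma extend1 : extend 1%:M = 1%:M.
Proof. by rewrite /extend subrr mulmx0 mul0mx addr0. Qed.

Lemma extend_tr A : (extend A)^T = extend A^T.
Proof.
by rewrite /extend linearD /= !trmx_mul trmxK trmx1 linearB /= trmx1 mulmxA.
Qed.

Lemma extendM A B : extend (A *m B) = extend A *m extend B.
Proof.
rewrite /extend; have -> : A *m B - 1%:M = (A - 1%:M) + (B - 1%:M) + (A - 1%:M) *m (B - 1%:M).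
  rewrite mulmxBl !mulmxBr !mulmx1 mul1mx; move: (A *m B) => C.
  by apply/matrixP => k l; rewrite !mxE; ring.
move: (A - 1%:M) (B - 1%:M) => X Y.
rewrite !mulmxDr !mulmxDl mul1mx mulmx1 !mul1mx.
by rewrite -!mulmxA (mulmxA glue_mx^T) glue_mxK mul1mx !addrA.
Qed.

Definition pad (A : 'M[R]_N) : 'M[R]_(N + d) := block_mx A 0 0 1%:M.

Lemma pad1 : pad 1%:M = 1%:M.
Proof. by rewrite /pad -scalar_mx_block. Qed.

Lemma padM A B : pad (A *m B) = pad A *m pad B.
Proof. by rewrite /pad mulmx_block !mulmx0 !mul0mx !mulmx1 !addr0 add0r. Qed.

Lemma pad_tr A : (pad A)^T = pad A^T.
Proof. by rewrite /pad tr_block_mx !trmx0 trmx1. Qed.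

Lemma pad_glue (A : 'M[R]_N) : (forall z, A z y = (z == y)%:R) -> pad A *m glue_mx = glue_mx.
Proof.
move=> Ay; apply/matrixP => k z; rewrite mul_glue_mx [RHS]mxE /glue_index.
rewrite -(fintype.splitK k); case: (fintype.split k) => {}k /=; case: (z == t).
- by rewrite block_mxEul Ay (inj_eq (@lshift_inj _ _)).
- by rewrite block_mxEur mxE eq_lrshift.
- by rewrite block_mxEdl mxE eq_rlshift.
- by rewrite block_mxEdr mxE (inj_eq (@rshift_inj _ _)).
Qed.

(** If A and its transpose fix vector y, then [pad A] fixes the glued subspace pointwise and
    preserves its complement, whereas [extend B] moves only the glued subspace. *)
Lemma extend_pad (A : 'M[R]_N) B :
  (forall z, A z y = (z == y)%:R) -> (forall z, A^T z y = (z == y)%:R) ->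
  pad A *m extend B = extend B *m pad A.
Proof.
move=> Ay ATy; rewrite /extend mulmxDr mulmxDl mulmx1 mul1mx; congr (_ + _).
rewrite mulmxA mulmxA pad_glue // -!mulmxA; congr (_ *m (_ *m _)).
by apply: trmx_inj; rewrite trmx_mul pad_tr trmxK pad_glue.
Qed.

(** A vector of the first space without component along y is orthogonal to the glued subspace. *)
Lemma extend_col_mx B (v : 'cV[R]_N) : v y 0 = 0 -> extend B *m col_mx v 0 = col_mx v 0.
Proof.
move=> vy; have E0 : glue_mx^T *m col_mx v 0 = 0 :> 'cV_d.
  apply/matrixP => z k; rewrite ord1 glue_mx_mul [RHS]mxE /glue_index.
  by case: ifP => _; rewrite ?col_mxEu ?col_mxEd ?mxE.
by rewrite /extend mulmxDl mul1mx -mulmxA E0 mulmx0 addr0.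
Qed.

Lemma extend_col_mx_entry B (v : 'cV[R]_N) s : s != t ->
  (extend B *m col_mx v 0) (rshift N s) 0 = B s t * v y 0.
Proof.
move=> st; rewrite /extend mulmxDl mul1mx mxE col_mxEd mxE add0r -!mulmxA.
rewrite mxE (bigD1 s) //= big1 ?addr0 => [|z zs]; last first.
  rewrite glue_mxE /glue_index; case: (z == t); first by rewrite eq_rlshift mul0r.
  by rewrite (inj_eq (@rshift_inj _ _)) eq_sym (negbTE zs) mul0r.
rewrite glue_mxE /glue_index (negbTE st) eqxx mul1r mxE (bigD1 t) //= big1 ?addr0 => [|z zt].
  by rewrite glue_mx_mul /glue_index eqxx col_mxEu !mxE (negbTE st) subr0.
by rewrite glue_mx_mul /glue_index (negbTE zt) col_mxEd [X in _ * X]mxE mulr0.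
Qed.

End glue.

Definition act N (phi : forall i, G i -> 'M[R]_N) (x : 'I_N) (w : seq letter) : 'cV[R]_N :=
  foldr (fun b v => phi (tag b) (tagged b) *m v) (delta_mx x 0) w.

(** Only proper suffixes are constrained: the full word is meant to reach y. *)
Fixpoint avoids N (phi : forall i, G i -> 'M[R]_N) x y (w : seq letter) : Prop :=
  if w is _ :: w' then act phi x w' y 0 = 0 /\ avoids phi x y w' else True.

(* y is the free end of the chain: only the leftmost letter of w moves it, and no
   vector met before that letter is applied has a component along it. Hence another
   letter can be glued at y without disturbing the earlier computation. *)
Lemma word_rep w : reduced w ->
  exists N (phi : forall i, G i -> 'M[R]_N) x y, [/\ rep_family phi,
    forall i, (if w is b :: _ then i <> tag b else True) ->
      forall g z, phi i g z y = (z == y)%:R,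
    act phi x w y 0 != 0 & avoids phi x y w].
Proof.
elim: w => [|[i0 a] w IH].
  exists 1%N, (fun _ _ => 1%:M), 0, 0; split=> //.
  - split=> // [i g h|i g|i k l].
    + by rewrite mulmx1.
    + by rewrite trmx1 mulmx1.
    + exact: cts_cst.
  - by move=> i _ g z; rewrite !mxE.
  - by rewrite /= !mxE oner_neq0.
move=> [/= /IH [N [phi [x [y [rphi fix_y actw avw]]]]] aH wi0].
(* The first letter of [w], if any, is not from [i0], so [G i0] fixes y. *)
have {}fix_y g z : phi i0 g z y = (z == y)%:R.
  by apply: fix_y; case: w wi0 {IH actw avw} => // b w; exact: nesym.
have [d [psi [s [t [rpsi psi1 st psia]]]]] := letter_rep aH.
pose U i g := pad d (phi i g); pose Ga i g := extend y t (psi i g).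
pose phi' i g := U i g *m Ga i g.
have [phiM phiT phic phi1] := rphi; have [psiM psiT psic psiH] := rpsi.
(* For i other than [i0] the new action is trivial; for [i0] the old action fixes y, so [extend_pad]
   applies. *)
have comm i g h : U i g *m Ga i h = Ga i h *m U i g.
  have [e|ne] := pselect (i = i0); last by rewrite /Ga psi1 // extend1 mulmx1 mul1mx.
  by subst i; apply: extend_pad => z; rewrite ?rep_family_tr.
have rphi' : rep_family phi'.
  split.
  - move=> i g h; rewrite /phi' /U /Ga phiM psiM padM extendM.
    by rewrite -!mulmxA; congr (_ *m _); rewrite !mulmxA; congr (_ *m _); exact: comm.
  - move=> i g; rewrite trmx_mul mulmxA -(mulmxA (U i g)) /Ga extend_tr -extendM.
    by rewrite psiT extend1 mulmx1 /U pad_tr -padM phiT pad1.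
  - move=> i k l.
    have -> : (fun g => phi' i g k l) = (fun g => \sum_j U i g k j * Ga i g j l).
      by apply/funext => g; rewrite mxE.
    apply: cts_sum => j; apply: cts_mul.
      rewrite /U -(fintype.splitK k) -(fintype.splitK j).
      case: (fintype.split k) => {}k; case: (fintype.split j) => {}j /=.
      + apply: (eq_cts (g := fun g => phi i g k j)) => [g|]; last exact: phic.
        by rewrite /pad block_mxEul.
      + apply: (eq_cts (g := fun=> 0)) => [g|]; last exact: cts_cst.
        by rewrite /pad block_mxEur mxE.
      + apply: (eq_cts (g := fun=> 0)) => [g|]; last exact: cts_cst.
        by rewrite /pad block_mxEdl mxE.
      + apply: (eq_cts (g := fun=> (1%:M : 'M[R]_d) k j)) => [g|]; last exact: cts_cst.
        by rewrite /pad block_mxEdr.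
    have -> : (fun g => Ga i g j l) = (fun g => (1%:M : 'M[R]_(N + d)) j l + \sum_z
       (\sum_z' glue_mx y t j z' * (psi i g z' z - (1%:M : 'M[R]_d) z' z)) * (glue_mx y t)^T z l).
      apply/funext => g; rewrite mxE; congr (_ + _); rewrite mxE; apply: eq_bigr => z _.
      by congr (_ * _); rewrite mxE; apply: eq_bigr => z' _; rewrite !mxE.
    apply: cts_add; first exact: cts_cst.
    apply: cts_sum => z; apply: cts_mul; last exact: cts_cst.
    apply: cts_sum => z'; apply: cts_mul; first exact: cts_cst.
    by apply: cts_sub; [exact: psic|exact: cts_cst].
  - by move=> i h; rewrite /phi' /U /Ga phi1 psiH pad1 extend1 mulmx1.
(* All vectors met before the last one lack a component along y, so the new action does not see
   them. *)
have actE v : avoids phi x y v -> act phi' (lshift d x) v = col_mx (act phi x v) 0.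
  elim: v => [_|b v IHv [/= vy avv]].
    apply/matrixP => k l; rewrite ord1 -(fintype.splitK k).
    case: (fintype.split k) => {}k /=; rewrite ?col_mxEu ?col_mxEd !mxE ?eqxx ?andbT.
      by rewrite (inj_eq (@lshift_inj _ _)).
    by rewrite eq_rlshift.
  rewrite /= IHv // /phi' -mulmxA extend_col_mx //.
  by rewrite /U mul_block_col !mul0mx mulmx0 !addr0.
have avoidsE v : avoids phi x y v -> avoids phi' (lshift d x) (rshift N s) v.
  elim: v => // b v IHv [/= vy avv]; split; last exact: IHv.
  by rewrite actE // col_mxEd mxE.
exists (N + d)%N, phi', (lshift d x), (rshift N s); split=> //.
- move=> i /= ii0 g z; rewrite /phi' /Ga psi1 // extend1 mulmx1 /U.
  rewrite -(fintype.splitK z); case: (fintype.split z) => {}z /=.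
    by rewrite block_mxEur mxE eq_lrshift.
  by rewrite block_mxEdr mxE (inj_eq (@rshift_inj _ _)).
(* By [comm] the old action of [a] may go first. It fixes y, hence keeps the nonzero component along
   y, of which the new action sends the multiple [psi i0 a s t] to s. *)
- rewrite /= actE // /phi' comm -mulmxA /U mul_block_col !mul0mx mulmx0 !addr0.
  rewrite extend_col_mx_entry // mulf_neq0 //.
  have -> : (phi i0 a *m act phi x w) y 0 = act phi x w y 0; last by [].
  have phiay z : phi i0 a y z = (z == y)%:R.
    by rewrite -[phi i0 a]trmxK mxE rep_family_tr // fix_y.
  rewrite mxE (bigD1 y) //= phiay eqxx mul1r big1 ?addr0 // => z zy.
  by rewrite phiay (negbTE zy) mul0r.
- split; last exact: avoidsE.
  by rewrite actE // col_mxEd mxE.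
Qed.

Definition word_prod (K : groupType) (k : forall i, G i -> K) (w : seq letter) : K :=
  foldr (fun b v => k (tag b) (tagged b) * v)%g 1%g w.

Lemma reduced_detect w : reduced w -> w <> [::] ->
  exists N (k : forall i, G i -> ortho R N), [/\ forall i, continuous_hom (k i),
    forall i h, k i (iota i h) = 1%g & word_prod k w <> 1%g].
Proof.
move=> /word_rep [N [phi [x [y [rphi _ actw avw]]]]] w0.
have [phiM phiT phic phi1] := rphi.
pose k i g : ortho R N := Ortho (introT eqP (phiT i g)).
exists N, k; split.
- move=> i; split; first by move=> g h; apply: val_inj; exact: phiM.
  by apply: cts_ortho => a b; exact: phic.
- by move=> i h; apply: val_inj; exact: phi1.
have actE v : act phi x v = word_prod k v *m delta_mx x 0.
  elim: v => [|b v IHv]; first by rewrite mul1mx.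
  by rewrite /= IHv mulmxA.
move=> w1; case: w w0 w1 actw avw => // b w _ w1 actw [/= avx avw].
(* The innermost clause of [avoids] concerns the empty suffix: for a nonempty word, x and y
   differ. *)
have xy : (delta_mx x 0 : 'cV[R]_N) y 0 = 0.
  by elim: w avx avw {w1 actw} => // b' w IHw _ [/= h1 h2]; exact: IHw.
by move: actw; rewrite actE w1 mul1mx xy eqxx.
Qed.

End words.

(** * Amalgams of abstract groups *)

Lemma hom1 (K L : groupType) (f : K -> L) : group_hom f -> f 1%g = 1%g.
Proof. by move=> fM; apply: (mulgI (f 1%g)); rewrite -fM !mulg1. Qed.

Lemma homV (K L : groupType) (f : K -> L) x : group_hom f -> f x^-1%g = (f x)^-1%g.
Proof.
by move=> fM; apply: (mulgI (f x)); rewrite -fM !mulgV hom1.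
Qed.

Section amalgam.
Local Open Scope quotient_scope.
Context {H : groupType} {I : Type} {G : I -> groupType}.
Variable iota : forall i, H -> G i.

Definition gen_word : Type := seq (H + {i : I & G i}).
HB.instance Definition _ := gen_eqMixin gen_word.
HB.instance Definition _ := gen_choiceMixin gen_word.

Definition eval_gen (K : groupType) (kH : H -> K) (k : forall i, G i -> K)
    (b : H + {i : I & G i}) : K :=
  match b with inl h => kH h | inr l => k (tag l) (tagged l) end.

Definition eval (K : groupType) (kH : H -> K) (k : forall i, G i -> K) (w : gen_word) : K :=
  foldr (fun b v => eval_gen kH k b * v)%g 1%g w.

(* Two words are identified when every cocone does so: the quotient is initial
   by construction. *)
Definition word_eq (w w' : gen_word) : bool :=
  `[< forall (K : groupType) (kH : H -> K) (k : forall i, G i -> K),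
      group_cocone iota kH k -> eval kH k w = eval kH k w' >].

Lemma word_eq_refl : reflexive word_eq.
Proof. by move=> w; apply/asboolP. Qed.

Lemma word_eq_sym : symmetric word_eq.
Proof.
by move=> w w'; apply/asboolP/asboolP => h K kH k ck; rewrite (h K kH k ck).
Qed.

Lemma word_eq_trans : transitive word_eq.
Proof.
move=> w w' w'' /asboolP h /asboolP h'; apply/asboolP => K kH k ck.
by rewrite (h K kH k ck) (h' K kH k ck).
Qed.

Canonical word_eq_equiv := EquivRel word_eq word_eq_refl word_eq_sym word_eq_trans.

Definition amalgam : Type := {eq_quot word_eq}.
HB.instance Definition _ := Choice.on amalgam.

Definition cls (w : gen_word) : amalgam := \pi_({eq_quot word_eq}) w.
Definition evq (K : groupType) (kH : H -> K) (k : forall i, G i -> K) (x : amalgam) : K :=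
  eval kH k (repr (x : {eq_quot word_eq})).

Lemma cls_repr (x : amalgam) : cls (repr (x : {eq_quot word_eq})) = x.
Proof. exact: reprK. Qed.

Lemma evq_cls (K : groupType) (kH : H -> K) (k : forall i, G i -> K) w :
  group_cocone iota kH k -> evq kH k (cls w) = eval kH k w.
Proof.
move=> ck; have /eqmodP : \pi_({eq_quot word_eq}) (repr (cls w : {eq_quot word_eq})) =
  \pi_({eq_quot word_eq}) w by rewrite reprK.
by move=> /asboolP; exact.
Qed.

(** Every group law of the amalgam is checked after evaluation in an actual group. *)
Lemma amalgam_ext (x y : amalgam) :
  (forall (K : groupType) (kH : H -> K) (k : forall i, G i -> K),
    group_cocone iota kH k -> evq kH k x = evq kH k y) -> x = y.
Proof.
move=> h; rewrite -(cls_repr x) -(cls_repr y); apply/eqmodP/asboolP.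
exact: h.
Qed.

Definition inv_gen (b : H + {i : I & G i}) : H + {i : I & G i} :=
  match b with inl h => inl h^-1%g | inr l => inr (Tagged G (tagged l)^-1%g) end.

Definition amalgam_mul (x y : amalgam) : amalgam :=
  cls (repr (x : {eq_quot word_eq}) ++ repr (y : {eq_quot word_eq})).
Definition amalgam_one : amalgam := cls [::].
Definition amalgam_inv (x : amalgam) : amalgam :=
  cls (rev (map inv_gen (repr (x : {eq_quot word_eq})))).

Section eval_morphism.
Context {K : groupType} {kH : H -> K} {k : forall i, G i -> K}.
Hypothesis ck : group_cocone iota kH k.

Lemma eval_cat w w' : eval kH k (w ++ w') = (eval kH k w * eval kH k w')%g.
Proof. by elim: w => [|b w IH]; rewrite ?mul1g //= IH mulgA. Qed.

Lemma eval_inv w : eval kH k (rev (map inv_gen w)) = (eval kH k w)^-1%g.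
Proof.
have [kHM kM _] := ck.
elim: w => [|b w IH]; first by rewrite invg1.
rewrite map_cons rev_cons -cats1 eval_cat IH /= mulg1 invgM; congr (_ * _)%g.
by case: b => [h|[i g]] /=; rewrite homV.
Qed.

Lemma evqM x y : evq kH k (amalgam_mul x y) = (evq kH k x * evq kH k y)%g.
Proof. by rewrite evq_cls // eval_cat. Qed.

Lemma evqV x : evq kH k (amalgam_inv x) = (evq kH k x)^-1%g.
Proof. by rewrite evq_cls // eval_inv. Qed.

Lemma evq1 : evq kH k amalgam_one = 1%g.
Proof. by rewrite evq_cls. Qed.

End eval_morphism.

Lemma amalgam_mulA : associative amalgam_mul.
Proof. by move=> x y z; apply: amalgam_ext => K kH k ck; rewrite !evqM // mulgA. Qed.
Lemma amalgam_mul1 : left_id amalgam_one amalgam_mul.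
Proof. by move=> x; apply: amalgam_ext => K kH k ck; rewrite evqM // evq1 // mul1g. Qed.
Lemma amalgam_1mul : right_id amalgam_one amalgam_mul.
Proof. by move=> x; apply: amalgam_ext => K kH k ck; rewrite evqM // evq1 // mulg1. Qed.
Lemma amalgam_mulV : left_inverse amalgam_one amalgam_inv amalgam_mul.
Proof.
by move=> x; apply: amalgam_ext => K kH k ck; rewrite evqM // evq1 // evqV // mulVg.
Qed.
Lemma amalgam_Vmul : right_inverse amalgam_one amalgam_inv amalgam_mul.
Proof.
by move=> x; apply: amalgam_ext => K kH k ck; rewrite evqM // evq1 // evqV // mulgV.
Qed.

HB.instance Definition _ := isGroup.Build amalgam
  amalgam_mulA amalgam_mul1 amalgam_1mul amalgam_mulV amalgam_Vmul.

Definition amalgamH (h : H) : amalgam := cls [:: inl h].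
Definition amalgamG i (g : G i) : amalgam := cls [:: inr (Tagged G g)].

Lemma amalgam_cocone : group_cocone iota amalgamH amalgamG.
Proof.
split=> [h h'|i g g'|i h]; apply: amalgam_ext => K kH k ck; have [kHM kM kc] := ck.
- by rewrite evqM // !evq_cls //= !mulg1 kHM.
- by rewrite evqM // !evq_cls //= !mulg1 kM.
- by rewrite !evq_cls //= !mulg1 kc.
Qed.

Lemma amalgam_ind (S : amalgam -> Prop) : S 1%g ->
  (forall h x, S x -> S (amalgamH h * x)%g) ->
  (forall i (g : G i) x, S x -> S (amalgamG g * x)%g) -> forall x, S x.
Proof.
move=> S1 SH SG x; rewrite -(cls_repr x).
elim: (repr _) => [//|b w IH].
have -> : cls (b :: w) = (cls [:: b] * cls w)%g.
  by apply: amalgam_ext => K kH k ck; rewrite evqM // !evq_cls //= mulg1.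
by case: b => [h|[i g]]; [exact: SH|exact: SG].
Qed.

Lemma amalgam_multipushout : is_group_multipushout iota amalgamH amalgamG.
Proof.
split; first exact: amalgam_cocone.
move=> K kH k ck; have uM : group_hom (evq kH k) by move=> x y; rewrite -evqM.
exists (evq kH k); split.
  by split=> //; split=> [h|i g]; rewrite evq_cls //= mulg1.
move=> v [vM [vH vG]]; apply/funext; apply: amalgam_ind.
- by rewrite !hom1.
- by move=> h x IH; rewrite vM uM IH vH evq_cls //= mulg1.
- by move=> i g x IH; rewrite vM uM IH vG evq_cls //= mulg1.
Qed.

End amalgam.
Arguments amalgamG {H I G} iota i g.

Lemma amalgam_normal_form (H : compactGroupType) (I : Type) (G : I -> compactGroupType)
    (iota : forall i, H -> G i) (x : amalgam iota) :
  exists (h : H) (w : seq letter), reduced iota w /\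
    x = (amalgamH iota h * word_prod (amalgamG iota) w)%g.
Proof.
have [pHM pM pc] := amalgam_cocone iota.
move: x; apply: (@amalgam_ind _ _ _ iota) => [|h' x [h [w [rw ->]]]|i g x [h [w [rw ->]]]].
- by exists 1%g, [::]; split=> //; rewrite /= (hom1 pHM) mulg1.
- by exists (h' * h)%g, w; split=> //; rewrite pHM mulgA.
(* The factor from H is absorbed into g, leaving one letter times a reduced word. *)
rewrite mulgA -(pc i) -pM; move: (g * _)%g => {}g.
have [[h' _ <-]|gH] := pselect (range (iota i) g).
  by exists h', w; rewrite pc.
have new : (if w is b' :: _ then tag b' <> i else True) ->
    exists (h0 : H) (w0 : seq letter), reduced iota w0 /\
      (amalgamG iota i g * word_prod (amalgamG iota) w)%g =
      (amalgamH iota h0 * word_prod (amalgamG iota) w0)%g.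
  move=> hd; exists 1%g, (Tagged G g :: w); split=> //.
  by rewrite (hom1 pHM) mul1g.
case: w rw new => [_|[i' g'] w rw] new; first exact: new.
have [e|ne] := pselect (i' = i); last exact: new.
subst i' => {new}; rewrite /= mulgA -pM; case: rw => rw g'H hd.
(* A merged letter may fall into H; the word then loses its head. *)
have [[h' _ <-]|gH'] := pselect (range (iota i) (g * g')%g).
  by exists h', w; rewrite pc.
by exists 1%g, (Tagged G (g * g')%g :: w); split=> //; rewrite (hom1 pHM) mul1g.
Qed.

Section symmetric_group.
Variable X : Type.

Record sym := Sym {
  sym_fun :> X -> X ; sym_inv : X -> X ;
  sym_funK : cancel sym_fun sym_inv ; sym_invK : cancel sym_inv sym_fun }.

HB.instance Definition _ := gen_eqMixin sym.
HB.instance Definition _ := gen_choiceMixin sym.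

Lemma sym_ext (f g : sym) : (forall x, f x = g x) -> f = g.
Proof.
case: f g => [f f' fK f'K] [g g' gK g'K] /= /funext fg; subst g.
have fg' : f' = g' by apply/funext => x; rewrite -{1}(g'K x) fK.
by subst g'; congr Sym; exact: Prop_irrelevance.
Qed.

Definition sym_one : sym := @Sym id id (fun=> erefl) (fun=> erefl).
Definition sym_mul (f g : sym) : sym :=
  @Sym (f \o g) (sym_inv g \o sym_inv f)
    (can_comp (sym_funK f) (sym_funK g)) (can_comp (sym_invK g) (sym_invK f)).
Definition sym_opp (f : sym) : sym := Sym (sym_invK f) (sym_funK f).

Lemma sym_mulA : associative sym_mul.
Proof. by move=> f g h; apply: sym_ext. Qed.
Lemma sym_mul1 : left_id sym_one sym_mul.
Proof. by move=> f; apply: sym_ext. Qed.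
Lemma sym_1mul : right_id sym_one sym_mul.
Proof. by move=> f; apply: sym_ext. Qed.
Lemma sym_mulV : left_inverse sym_one sym_opp sym_mul.
Proof. by move=> f; apply: sym_ext => x /=; rewrite sym_funK. Qed.
Lemma sym_Vmul : right_inverse sym_one sym_opp sym_mul.
Proof. by move=> f; apply: sym_ext => x /=; rewrite sym_invK. Qed.

HB.instance Definition _ := isGroup.Build sym sym_mulA sym_mul1 sym_1mul sym_mulV sym_Vmul.

End symmetric_group.

(** * Injectivity of the legs of the abstract multi-pushout *)

Section faithful_cocone.
Context {H : groupType} {I : Type} {G : I -> groupType}.
Variable iota : forall i, H -> G i.
Hypothesis iotaM : forall i, group_hom (iota i).
Hypothesis iota_inj : forall i, injective (iota i).

(** The choice is applied to the coset as a set, so equal cosets get equal representatives by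
    extensionality. *)
Definition crep i (g : G i) : G i := xget 1%g [set c | exists h, c = (iota i h * g)%g].
Definition cofactor i (g : G i) : H := xget 1%g [set h | g = (iota i h * crep g)%g].

Lemma crepM i h (g : G i) : crep (iota i h * g)%g = crep g.
Proof.
congr (xget 1%g); apply/seteqP; split=> c /= [h' ->].
  by exists (h' * h)%g; rewrite iotaM mulgA.
by exists (h' * h^-1)%g; rewrite iotaM homV // -mulgA mulKg.
Qed.

Lemma cofactorK i (g : G i) : g = (iota i (cofactor g) * crep g)%g.
Proof.
have [h hE] : exists h, crep g = (iota i h * g)%g.
  apply: (@xgetPex _ 1%g [set c | exists h, c = (iota i h * g)%g]).
  by exists g, 1%g; rewrite hom1 // mul1g.
apply: (@xgetPex _ 1%g [set h | g = (iota i h * crep g)%g]).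
by exists h^-1%g; rewrite /= hE homV // mulKg.
Qed.

Lemma crepK i (g : G i) : crep (crep g) = crep g.
Proof. by rewrite {2}(cofactorK g) crepM. Qed.

Lemma cofactorM i h (c : G i) : crep c = c -> cofactor (iota i h * c)%g = h.
Proof.
move=> cc; have := cofactorK (iota i h * c)%g.
by rewrite crepM cc => /mulIg /iota_inj.
Qed.

Definition transversal i := {c : G i | crep c = c}.
(** The left H-sets [G i] may have different numbers of orbits. Infinitely many copies of every
    transversal even this out. *)
Definition streams := forall i, nat -> transversal i.

Definition update (y : streams) i (f : nat -> transversal i) : streams := fun j =>
  if pselect (i = j) is left e then ecast k (nat -> transversal k) e f else y j.
Arguments update y i f : clear implicits.

Lemma update_same y i f : update y i f i = f.
Proof.
by rewrite /update; case: pselect => // e; rewrite (Prop_irrelevance e erefl).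
Qed.

Lemma update_update y i f f' : update (update y i f) i f' = update y i f'.
Proof. by apply: functional_extensionality_dep => j; rewrite /update; case: pselect. Qed.

Lemma update_id y i : update y i (y i) = y.
Proof.
by apply: functional_extensionality_dep => j; rewrite /update; case: pselect => // e; case: _ / e.
Qed.

(* Hilbert's hotel: the i-th stream absorbs a coset representative, so that
   [H * streams] and [G i * streams] are isomorphic left [H]-sets. *)
Definition absorb i (gy : G i * streams) : H * streams :=
  (cofactor gy.1, update gy.2 i (fun n => if n is m.+1 then gy.2 i m else exist _ _ (crepK gy.1))).

Definition release i (hy : H * streams) : G i * streams :=
  ((iota i hy.1 * sval (hy.2 i 0%N))%g, update hy.2 i (fun n => hy.2 i n.+1)).

Lemma absorbK i : cancel (@absorb i) (@release i).
Proof.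
move=> [g y]; rewrite /release /absorb /= update_same /= -cofactorK; congr pair.
by rewrite update_update -[RHS](update_id y i).
Qed.

Lemma releaseK i : cancel (@release i) (@absorb i).
Proof.
move=> [h y]; rewrite /release /absorb /= update_same; have cc := svalP (y i 0%N).
rewrite cofactorM //; congr pair; rewrite update_update -[RHS](update_id y i); congr update.
apply/funext => -[|n] //; case: (y i 0%N) cc => c cE /= _.
by apply: eq_exist; rewrite crepM.
Qed.

Definition act_fun i (g : G i) (x : H * streams) : H * streams :=
  absorb ((g * (release i x).1)%g, (release i x).2).

Lemma act_funM i (g g' : G i) x : act_fun (g * g')%g x = act_fun g (act_fun g' x).
Proof.
rewrite /act_fun absorbK; congr absorb; congr pair.
exact/esym/mulgA.
Qed.

Lemma act_fun1 i x : act_fun (1%g : G i) x = x.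
Proof. by rewrite /act_fun mul1g -surjective_pairing releaseK. Qed.

Lemma act_funK i (g : G i) : cancel (act_fun g) (act_fun g^-1%g).
Proof. by move=> x; rewrite -act_funM mulVg act_fun1. Qed.

Lemma act_funVK i (g : G i) : cancel (act_fun g^-1%g) (act_fun g).
Proof. by move=> x; rewrite -act_funM mulgV act_fun1. Qed.

Definition act_sym i (g : G i) : sym (H * streams) := Sym (act_funK g) (act_funVK g).

(** [release] is H-equivariant, so elements of H act by the same translation for every i; this is
    what makes the actions a cocone. *)
Lemma act_fun_iota i h x : act_fun (iota i h) x = ((h * x.1)%g, x.2).
Proof.
case: x => h' y; rewrite -[RHS](releaseK i) /act_fun; congr absorb.
by rewrite /release /= iotaM mulgA.
Qed.

Lemma transl_K (h : H) : cancel (fun x : H * streams => ((h * x.1)%g, x.2))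
  (fun x => ((h^-1 * x.1)%g, x.2)).
Proof. by move=> [h' y]; rewrite /= mulKg. Qed.

Lemma transl_VK (h : H) : cancel (fun x : H * streams => ((h^-1 * x.1)%g, x.2))
  (fun x => ((h * x.1)%g, x.2)).
Proof. by move=> [h' y]; rewrite /= mulVKg. Qed.

Definition transl_sym h : sym (H * streams) := Sym (transl_K h) (transl_VK h).

Lemma act_sym_cocone : group_cocone iota transl_sym act_sym.
Proof.
split=> [h h'|i g g'|i h]; apply: sym_ext => x /=.
- by rewrite mulgA.
- by rewrite act_funM.
- by rewrite act_fun_iota.
Qed.

Lemma act_sym_inj i : injective (@act_sym i).
Proof.
(* The action of [G i] is free, so one point is enough; constant streams provide it. *)
move=> g g' /(congr1 (fun s : sym _ => s (1%g, fun j n => exist _ _ (crepK (1%g : G j))))).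
move=> /= /(can_inj (@absorbK i)) [].
exact: mulIg.
Qed.

Lemma multipushout_leg_inj (P : groupType) (pH : H -> P) (p : forall i, G i -> P) :
  is_group_multipushout iota pH p -> forall i, injective (p i).
Proof.
move=> [_ /(_ _ _ _ act_sym_cocone) [u [[_ [_ up]] _]]] i g g' e.
by apply: act_sym_inj; rewrite -!up e.
Qed.

End faithful_cocone.

(** * Completions of groups in compact groups *)

Section completion.
Local Open Scope quotient_scope.
Context {P : groupType}.
Variable adm : forall K : compactGroupType, (P -> K) -> Prop.

(** The completion is the universal compact group for these homomorphisms, a Bohr compactification
    relative to [adm]. *)
Definition coherent (K : compactGroupType) (u : P -> K) := group_hom u /\ adm u.

(* The points of the completion are given by filters on P rather than by families
   indexed by all coherent homomorphisms, which would not form a small type. *)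
Record cauchy_filter : Type := CauchyFilter {
  cf_sets :> set_system P ;
  cf_proper : ProperFilter cf_sets ;
  cf_cvg : forall (K : compactGroupType) (u : P -> K), coherent u ->
    exists l : K, u @ cf_sets --> l }.

HB.instance Definition _ := gen_eqMixin cauchy_filter.
HB.instance Definition _ := gen_choiceMixin cauchy_filter.

Definition cf_lim (K : compactGroupType) (u : P -> K) (F : cauchy_filter) : K :=
  xget 1%g [set l : K | u @ cf_sets F --> l].

Lemma cf_limP (K : compactGroupType) (u : P -> K) (F : cauchy_filter) :
  coherent u -> u @ cf_sets F --> cf_lim u F.
Proof. by move=> /(cf_cvg F) h; exact: (xgetPex 1%g h). Qed.
Arguments cf_limP {K u} F _.

Lemma cf_lim_eq (K : compactGroupType) (u : P -> K) (F : cauchy_filter) (l : K) :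
  coherent u -> u @ cf_sets F --> l -> cf_lim u F = l.
Proof.
move=> cu Fl; have FP := cf_proper F.
exact: (cvg_unique (@hausdorffG K) (cf_limP F cu) Fl).
Qed.

Definition cf_eq (F F' : cauchy_filter) : bool :=
  `[< forall (K : compactGroupType) (u : P -> K), coherent u -> cf_lim u F = cf_lim u F' >].

Lemma cf_eq_refl : reflexive cf_eq.
Proof. by move=> F; apply/asboolP. Qed.

Lemma cf_eq_sym : symmetric cf_eq.
Proof. by move=> F F'; apply/asboolP/asboolP => h K u cu; rewrite (h K u cu). Qed.

Lemma cf_eq_trans : transitive cf_eq.
Proof.
move=> F F' F'' /asboolP h /asboolP h'; apply/asboolP => K u cu.
by rewrite (h K u cu) (h' K u cu).
Qed.

Canonical cf_eq_equiv := EquivRel cf_eq cf_eq_refl cf_eq_sym cf_eq_trans.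

Definition completion : Type := {eq_quot cf_eq}.
HB.instance Definition _ := Choice.on completion.

Definition cfrepr (x : completion) : cauchy_filter := repr (x : {eq_quot cf_eq}).
Definition cfcls (F : cauchy_filter) : completion := \pi_({eq_quot cf_eq}) F.
Definition ext (K : compactGroupType) (u : P -> K) (x : completion) : K := cf_lim u (cfrepr x).

Lemma ext_cls (K : compactGroupType) (u : P -> K) F : coherent u ->
  ext u (cfcls F) = cf_lim u F.
Proof.
move=> cu; have /eqmodP : \pi_({eq_quot cf_eq}) (cfrepr (cfcls F)) = \pi_({eq_quot cf_eq}) F.
  by rewrite reprK.
by move=> /asboolP; exact.
Qed.

Lemma completion_ext (x y : completion) :
  (forall (K : compactGroupType) (u : P -> K), coherent u -> ext u x = ext u y) -> x = y.
Proof.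
move=> h; rewrite -[x](reprK (x : {eq_quot cf_eq})) -[y](reprK (y : {eq_quot cf_eq})).
by apply/eqmodP/asboolP; exact: h.
Qed.

(** A point is specified by its coordinates under all coherent homomorphisms, provided one filter on
    P realizes them simultaneously. *)
Lemma completion_of_filter (F : set_system P) (l : forall K : compactGroupType, (P -> K) -> K) :
  ProperFilter F -> (forall (K : compactGroupType) (u : P -> K), coherent u -> u @ F --> l K u) ->
  exists x : completion, forall (K : compactGroupType) (u : P -> K), coherent u -> ext u x = l K u.
Proof.
move=> FP Fl.
have Fc (K : compactGroupType) (u : P -> K) : coherent u -> exists l : K, u @ F --> l.
  by move=> cu; exists (l K u); exact: Fl.
exists (cfcls (CauchyFilter FP Fc)) => K u cu; rewrite ext_cls //.
by apply: cf_lim_eq => //; exact: Fl.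
Qed.

Lemma cf_mul (x y : completion) : exists z : completion,
  forall (K : compactGroupType) (u : P -> K), coherent u -> ext u z = (ext u x * ext u y)%g.
Proof.
have xP := cf_proper (cfrepr x); have yP := cf_proper (cfrepr y).
apply: (@completion_of_filter
  ((fun ab : P * P => (ab.1 * ab.2)%g) @ filter_prod (cf_sets (cfrepr x)) (cf_sets (cfrepr y)))
  (fun K u => ext u x * ext u y)%g) => K u cu.
have h1 : (fun ab : P * P => u ab.1) @ filter_prod (cf_sets (cfrepr x)) (cf_sets (cfrepr y)) -->
    ext u x by apply: cvg_comp (cf_limP (cfrepr x) cu); exact: cvg_fst.
have h2 : (fun ab : P * P => u ab.2) @ filter_prod (cf_sets (cfrepr x)) (cf_sets (cfrepr y)) -->
    ext u y by apply: cvg_comp (cf_limP (cfrepr y) cu); exact: cvg_snd.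
have := cvg_comp _ _ (cvg_pair h1 h2) (@mulg_continuous K (ext u x, ext u y)).
have -> : (fun xy : K * K => (xy.1 * xy.2)%g) \o (fun ab : P * P => (u ab.1, u ab.2)) =
    u \o (fun ab : P * P => (ab.1 * ab.2)%g).
  by apply/funext => ab /=; rewrite cu.1.
by apply.
Qed.

Lemma cf_inv (x : completion) : exists z : completion,
  forall (K : compactGroupType) (u : P -> K), coherent u -> ext u z = (ext u x)^-1%g.
Proof.
have xP := cf_proper (cfrepr x).
apply: (@completion_of_filter ((fun a : P => a^-1%g) @ cf_sets (cfrepr x))
  (fun K u => (ext u x)^-1)%g) => K u cu.
have := cvg_comp _ _ (cf_limP (cfrepr x) cu) (@invg_continuous K (ext u x)).
have -> // : (fun a : K => a^-1%g) \o u = u \o (fun a : P => a^-1%g).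
by apply/funext => a /=; rewrite homV //; exact: cu.1.
Qed.

Lemma cf_unit (p : P) : exists z : completion,
  forall (K : compactGroupType) (u : P -> K), coherent u -> ext u z = u p.
Proof.
have pP := @ultra_proper _ _ (principal_filter_ultra p).
apply: (@completion_of_filter (principal_filter p) (fun K u => u p)) => K u cu A Ap.
by apply/principal_filterP; exact: nbhs_singleton.
Qed.

Definition cmul x y := projT1 (cid (cf_mul x y)).
Definition cinv x := projT1 (cid (cf_inv x)).
Definition cunit p := projT1 (cid (cf_unit p)).

Section ext_morphism.
Context {K : compactGroupType} {u : P -> K}.
Hypothesis cu : coherent u.

Lemma ext_mul x y : ext u (cmul x y) = (ext u x * ext u y)%g.
Proof. exact: (projT2 (cid (cf_mul x y)) K u cu). Qed.

Lemma ext_inv x : ext u (cinv x) = (ext u x)^-1%g.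
Proof. exact: (projT2 (cid (cf_inv x)) K u cu). Qed.

Lemma ext_unit p : ext u (cunit p) = u p.
Proof. exact: (projT2 (cid (cf_unit p)) K u cu). Qed.

Lemma ext_one : ext u (cunit 1%g) = 1%g.
Proof. by rewrite ext_unit hom1 //; exact: cu.1. Qed.

End ext_morphism.

Lemma cmulA : associative cmul.
Proof. by move=> x y z; apply: completion_ext => K u cu; rewrite !ext_mul // mulgA. Qed.
Lemma cmul1 : left_id (cunit 1%g) cmul.
Proof. by move=> x; apply: completion_ext => K u cu; rewrite ext_mul // ext_one // mul1g. Qed.
Lemma c1mul : right_id (cunit 1%g) cmul.
Proof. by move=> x; apply: completion_ext => K u cu; rewrite ext_mul // ext_one // mulg1. Qed.
Lemma cmulV : left_inverse (cunit 1%g) cinv cmul.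
Proof.
by move=> x; apply: completion_ext => K u cu; rewrite ext_mul // ext_one // ext_inv // mulVg.
Qed.
Lemma cVmul : right_inverse (cunit 1%g) cinv cmul.
Proof.
by move=> x; apply: completion_ext => K u cu; rewrite ext_mul // ext_one // ext_inv // mulgV.
Qed.

HB.instance Definition _ := isGroup.Build completion cmulA cmul1 c1mul cmulV cVmul.

Definition subbasic (A : set completion) := exists (K : compactGroupType) (u : P -> K) (O : set K),
  [/\ coherent u, open O & A = ext u @^-1` O].

(* The coarsest topology making every [ext u] continuous, described through its
   neighbourhood filters: the least filter containing the subbasic sets at x. *)
Definition cnbhs (x : completion) : set_system completion :=
  [set A | forall F : set_system completion, Filter F ->
    (forall B, subbasic B -> B x -> F B) -> F A].

Lemma cnbhs_subbasic x B : subbasic B -> B x -> cnbhs x B.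
Proof. by move=> sB Bx F FF; exact. Qed.

Lemma cnbhs_sing x A : cnbhs x A -> A x.
Proof.
move=> /(_ [set B : set completion | B x]); apply=> //.
by split=> // B C BC; exact: BC.
Qed.

Instance cnbhs_filter x : Filter (cnbhs x).
Proof.
split=> [F FF _|A B nA nB F FF h|A B AB nA F FF h].
- exact: filterT.
- by apply: filterI; [exact: nA|exact: nB].
- by apply: filterS AB _; exact: nA.
Qed.

Lemma cnbhs_proper x : ProperFilter (cnbhs x).
Proof. by split; [move=> /cnbhs_sing|exact: cnbhs_filter]. Qed.

Lemma cnbhs_nbhs x A : cnbhs x A -> cnbhs x (cnbhs^~ A).
Proof.
(* Minimality of [cnbhs x] is applied to the filter of all sets with the desired property, which
   contains the subbasic sets at x. *)
move=> /(_ [set B | cnbhs x (cnbhs^~ B)]); apply.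
  split=> [|B C nB nC|B C BC].
  - by apply: (@filterE _ (cnbhs x)) => y; exact: filterT.
  - rewrite /=; move: nB nC; apply: (@filterS2 _ (cnbhs x)) => y; exact: filterI.
  - by apply: (@filterS _ (cnbhs x)) => y; exact: (filterS BC).
move=> B sB Bx; apply: (@filterS _ (cnbhs x)) (cnbhs_subbasic sB Bx) => y By.
exact: cnbhs_subbasic.
Qed.

HB.instance Definition _ := hasNbhs.Build completion cnbhs.
HB.instance Definition _ := Nbhs_isNbhsTopological.Build completion
  cnbhs_proper cnbhs_sing cnbhs_nbhs.

Lemma cvg_completion (F : set_system completion) (x : completion) : Filter F ->
  (forall (K : compactGroupType) (u : P -> K) (O : set K), coherent u -> open O -> O (ext u x) ->
     F (ext u @^-1` O)) -> F --> x.
Proof. by move=> FF h A; apply=> // B [K [u [O [cu oO ->]]]]; exact: h. Qed.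

Lemma ext_continuous (K : compactGroupType) (u : P -> K) : coherent u -> continuous (ext u).
Proof.
move=> cu x A; rewrite nbhsE => -[O [oO Ox] OA].
have : cnbhs x (ext u @^-1` O) by apply: cnbhs_subbasic => //; exists K, u, O.
by apply: (@filterS _ (cnbhs x)) => y; exact: OA.
Qed.

Lemma cts_completion (X : topologicalType) (f : X -> completion) :
  (forall (K : compactGroupType) (u : P -> K), coherent u ->
    continuous (fun x => ext u (f x))) -> continuous f.
Proof.
move=> cf x; apply: cvg_completion => K u O cu oO Ox.
by apply: (cf K u cu x); exact: open_nbhs_nbhs.
Qed.

Lemma cmul_continuous : continuous (fun xy : completion * completion => (xy.1 * xy.2)%g).
Proof.
apply: cts_completion => K u cu.
apply: (eq_cts (g := fun xy => (ext u xy.1 * ext u xy.2)%g)); first by move=> xy; exact: ext_mul.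
apply: cts_mulg; apply: cts_comp (ext_continuous cu) => xy; [exact: cvg_fst|exact: cvg_snd].
Qed.

Lemma cinv_continuous : continuous (fun x : completion => x^-1%g).
Proof.
apply: cts_completion => K u cu.
apply: (eq_cts (g := fun x => (ext u x)^-1%g)); first by move=> x; exact: ext_inv.
by apply: cts_invg; exact: ext_continuous.
Qed.

HB.instance Definition _ := Group_isTopologicalGroup.Build completion
  cmul_continuous cinv_continuous.

Lemma completion_compact : compact [set: completion].
Proof.
rewrite compact_ultra => F FU _; have FP : ProperFilter F by exact: ultra_proper.
have lim (K : compactGroupType) (u : P -> K) : exists l : K, ext u @ F --> l.
  by apply: (@ultra_lim _ K F [set: K] (ext u)) => //; exact: compactG.
pose l (K : compactGroupType) (u : P -> K) : K := projT1 (cid (lim K u)).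
have lP (K : compactGroupType) (u : P -> K) : ext u @ F --> l K u.
  exact: (projT2 (cid (lim K u))).
(* The iterated filter: A is large when it is large for the filters representing [F]-almost all
   points. Its limit under a coherent u is that of [ext u] along [F]. *)
pose Phi : set_system P := [set A | \forall x \near F, cf_sets (cfrepr x) A].
have PhiP : ProperFilter Phi.
  split; last split.
  - move=> h; have [x] := filter_ex (F := F) h.
    by have [] := cf_proper (cfrepr x).
  - apply: (@filterE _ F) => x; have := cf_proper (cfrepr x) => ?.
    exact: filterT.
  - move=> A B; apply: (@filterS2 _ F) => x; have := cf_proper (cfrepr x) => ?.
    exact: filterI.
  - move=> A B AB; apply: (@filterS _ F) => x; have := cf_proper (cfrepr x) => ?.
    exact: filterS.
have [q hq] : exists x : completion,
    forall (K : compactGroupType) (u : P -> K), coherent u -> ext u x = l K u.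
  apply: (@completion_of_filter Phi l) => K u cu A; rewrite nbhsE => -[O [oO Ol] OA].
  have nO : nbhs (l K u) O by exact: open_nbhs_nbhs.
  have := lP K u O nO; apply: (@filterS _ F) => x Ox.
  have := cf_limP (cfrepr x) cu O (open_nbhs_nbhs (conj oO Ox)).
  have := cf_proper (cfrepr x) => ?; apply: (@filterS _ (cf_sets (cfrepr x))) => p.
  exact: OA.
exists q; split=> //; apply: cvg_completion => K u O cu oO; rewrite hq // => Ol.
by apply: (lP K u O); exact: open_nbhs_nbhs.
Qed.

Lemma completion_hausdorff : hausdorff_space completion.
Proof.
move=> x y xy; apply: completion_ext => K u cu.
exact: cluster_continuous (@hausdorffG K) (ext_continuous cu) xy.
Qed.

HB.instance Definition _ := TopologicalGroup_isCompactGroup.Build completion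
  completion_compact completion_hausdorff.

Lemma cunitM : group_hom cunit.
Proof.
by move=> p q; apply: completion_ext => K u cu; rewrite [RHS]ext_mul // !ext_unit // cu.1.
Qed.

Lemma ext_hom (K : compactGroupType) (u : P -> K) : coherent u -> continuous_hom (ext u).
Proof.
by move=> cu; split; [move=> x y; exact: ext_mul|exact: ext_continuous].
Qed.

(** The image of [cunit] is dense: each point is the limit of [cunit] along the filter that
    represents it. *)
Lemma ext_unique (K : compactGroupType) (u : P -> K) (v : completion -> K) :
  coherent u -> continuous v -> (forall p, v (cunit p) = u p) -> v = ext u.
Proof.
move=> cu cv vu; apply/funext => x; have xP := cf_proper (cfrepr x).
have dx : cunit @ cf_sets (cfrepr x) --> x.
  apply: cvg_completion => L w O cw oO Ox.
  have := cf_limP (cfrepr x) cw O (open_nbhs_nbhs (conj oO Ox)).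
  by apply: (@filterS _ (cf_sets (cfrepr x))) => p; rewrite /= ext_unit.
have h1 : (fun p => v (cunit p)) @ cf_sets (cfrepr x) --> v x.
  exact: (cvg_comp _ _ dx (cv x)).
rewrite (funext vu) in h1.
exact: (cvg_unique (@hausdorffG K) h1 (cf_limP (cfrepr x) cu)).
Qed.

End completion.

(** * The multi-pushout of compact groups *)

Section compact_pushout.
Context {H : compactGroupType} {I : Type} {G : I -> compactGroupType}.
Variable iota : forall i, H -> G i.

Local Notation pH := (amalgamH (G := fun i => G i) iota).
Local Notation p := (amalgamG (G := fun i => G i) iota).

(** The abstract amalgam has no topology here; continuity is asked only on the legs, so coherent
    homomorphisms correspond to cocones of compact groups. *)
Definition legs_continuous (K : compactGroupType) (u : amalgam iota -> K) : Prop :=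
  continuous (fun h => u (pH h)) /\ forall i, continuous (fun g => u (p i g)).

Local Notation cu := (cunit legs_continuous).

Lemma compact_cocone_group (K : compactGroupType) (kH : H -> K) (k : forall i, G i -> K) :
  compact_group_cocone iota kH k -> group_cocone iota kH k.
Proof. by move=> [[kHM _] kc ck]; split=> // i; have [] := kc i. Qed.

Lemma compact_cocone_map (K : compactGroupType) (kH : H -> K) (k : forall i, G i -> K) :
  compact_group_cocone iota kH k -> is_cocone_map pH p kH k (evq kH k).
Proof.
by move=> /compact_cocone_group ck; split=> [h|i g]; rewrite evq_cls //= mulg1.
Qed.

Lemma coherent_evq (K : compactGroupType) (kH : H -> K) (k : forall i, G i -> K) :
  compact_group_cocone iota kH k -> coherent legs_continuous (evq kH k).
Proof.
move=> ck; have [eH eG] := compact_cocone_map ck; split.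
  by move=> x y; rewrite -evqM //; exact: compact_cocone_group.
have [[_ kHc] kc _] := ck; split=> [|i].
- exact: (eq_cts (g := kH)).
- by apply: (eq_cts (g := k i)) => //; have [] := kc i.
Qed.

Lemma completion_multipushout :
  is_compact_group_multipushout iota (cu \o pH) (fun i => cu \o p i).
Proof.
have [pHM pM pc] := amalgam_cocone iota.
split; first split.
- split; first by move=> x y; rewrite /= pHM cunitM.
  apply: cts_completion => K u hu; have [_ [uH _]] := hu.
  by apply: (eq_cts _ uH) => x; exact: ext_unit.
- move=> i; split; first by move=> x y; rewrite /= pM cunitM.
  apply: cts_completion => K u hu; have [_ [_ uG]] := hu.
  by apply: (eq_cts _ (uG i)) => x; exact: ext_unit.
- by move=> i x /=; rewrite pc.
move=> K kH k ck; have hu := coherent_evq ck; have [eH eG] := compact_cocone_map ck.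
exists (ext (evq kH k)); split.
  by split; [exact: ext_hom|split=> [x|i x]; rewrite /= ext_unit].
move=> v [[vM vc] [vH vG]]; apply/esym/ext_unique => // x; move: x.
have vuM : group_hom (v \o cu) by move=> x y; rewrite /= cunitM vM.
apply: (@amalgam_ind _ _ _ iota) => [|h x IH|i g x IH].
- by rewrite [LHS](hom1 vuM) [RHS](hom1 hu.1).
- by rewrite [LHS](vuM) hu.1 /= IH eH -vH.
- by rewrite [LHS](vuM) hu.1 /= IH eG -vG.
Qed.

Lemma evq_word_prod (K : groupType) (kH : H -> K) (k : forall i, G i -> K) w :
  group_cocone iota kH k -> evq kH k (word_prod p w) = word_prod k w.
Proof.
move=> ck; elim: w => [|b w IH]; first by rewrite [LHS]evq1.
by rewrite /= [LHS]evqM // IH evq_cls //= mulg1.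
Qed.

Hypothesis iota_embedding : forall i, embedding (iota i).
Hypothesis iota_normal : forall i, normal_subgroup (range (iota i)).

Lemma coherently_embeddable_detectH h : coherently_embeddable iota -> h <> 1%g ->
  exists (K : compactGroupType) (kH : H -> K) (k : forall i, G i -> K),
    compact_group_cocone iota kH k /\ kH h <> 1%g.
Proof.
move=> [K [j [jemb jj]]] h1.
(* For empty I a coherent embedding carries no information on H, and the identity of H is itself a
   cocone. *)
have [[i0 _]|noI] := pselect (exists i : I, True); last first.
  have absurd (i : I) : False by apply: noI; exists i.
  exists H, id, (fun i _ => 1%g); split=> //; split=> [|i|i]; try by case: (absurd i).
  by split=> // x; exact: cvg_id.
have [[jM jc] jinj] := jemb i0; have [[iM ic] iinj] := iota_embedding i0.
exists K, (j i0 \o iota i0), j; split.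
  split=> [|i|i x]; [|by have [] := jemb i|exact: jj].
  by split; [move=> x y; rewrite /= iM jM|exact: cts_comp].
move=> e; apply: h1; apply: iinj; apply: jinj.
by rewrite (hom1 iM) (hom1 jM).
Qed.

Lemma coherently_embeddable_detect (z : amalgam iota) :
  coherently_embeddable iota -> z <> 1%g ->
  exists (K : compactGroupType) (kH : H -> K) (k : forall i, G i -> K),
    compact_group_cocone iota kH k /\ evq kH k z <> 1%g.
Proof.
move=> emb; have [h [w [rw ->]]] := amalgam_normal_form z => z1.
have [pHM _ _] := amalgam_cocone iota.
case: (eqVneq (size w) 0%N) => [/size0nil w0|w0].
  subst w; have h1 : h <> 1%g by move=> h1; apply: z1; rewrite h1 (hom1 pHM) mul1g.
  have [K [kH [k [ck kh]]]] := coherently_embeddable_detectH emb h1.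
  exists K, kH, k; split=> //; have gk := compact_cocone_group ck.
  by rewrite /= mulg1 evq_cls //= mulg1.
have wn : w <> [::] by move=> wn; rewrite wn in w0.
have [N [k [kc k1 kw]]] := reduced_detect (R := Rdefinitions.R)
  (fun i => (iota_embedding i).1) iota_normal rw wn.
(* This cocone kills the factor [h], so only the reduced word is left to detect. *)
have ck : compact_group_cocone iota (fun=> 1%g) k.
  split=> //; split; first by move=> x y; rewrite mulg1.
  by move=> x; exact: cvg_cst.
have gk := compact_cocone_group ck.
exists (ortho Rdefinitions.R N), (fun=> 1%g), k; split=> //.
by rewrite [evq _ _ _]evqM // evq_word_prod // evq_cls //= mulg1 mul1g.
Qed.

Lemma coherently_embeddable_sound : coherently_embeddable iota -> algebraically_sound iota.
Proof.
move=> emb; exists (amalgam iota), pH, p, (completion legs_continuous), (cu \o pH),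
  (fun i => cu \o p i), cu; split.
- exact: amalgam_multipushout.
- exact: completion_multipushout.
- by split; [exact: cunitM|].
move=> x y xy; suff e : (x^-1 * y)%g = 1%g by apply: (mulgI x^-1%g); rewrite e mulVg.
apply: contrapT => /(coherently_embeddable_detect emb) [K [kH [k [ck]]]]; apply.
have hu := coherent_evq ck.
have exy : evq kH k x = evq kH k y by rewrite -!(ext_unit hu) xy.
by rewrite hu.1 -exy (homV _ hu.1) mulVg.
Qed.

Lemma sound_coherently_embeddable : algebraically_sound iota -> coherently_embeddable iota.
Proof.
move=> [P [qH [q [Q [rH [r [c [isP isQ [cM [cH cG]] cinj]]]]]]]].
have [[rHc rc ccr] _] := isQ.
exists Q, r; split=> [i|i i' x]; last by rewrite !ccr.
split; first exact: rc.
move=> g g'; rewrite -!cG => /cinj; apply: (multipushout_leg_inj _ _ isP).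
- by move=> i'; exact: (iota_embedding i').1.1.
- by move=> i'; exact: (iota_embedding i').2.
Qed.

End compact_pushout.

Theorem theorem2p17 (H : compactGroupType) (I : Type)
    (G : I -> compactGroupType) (iota : forall i : I, H -> G i)
    (iota_embedding : forall i : I, embedding (iota i))
    (iota_normal : forall i : I, normal_subgroup (range (iota i))) :
  algebraically_sound iota <-> coherently_embeddable iota.
Proof.
split; first exact: sound_coherently_embeddable.
exact: coherently_embeddable_sound.
Qed.
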